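(* Let $X,X_1,X_2,\dots$ be i.i.d. real random variables, and let $S_n=\sum_{i=1}^nX_i$ and $G_n=\frac1n\sum_{i=1}^nS_i$ for $n\ge 1$. Suppose that either of the following two conditions holds. (i) $\mathbb{E}|X|\in(0,\infty)$ and $X$ has the same distribution as $-X$. (ii) $\mathbb{E}[X^2]<\infty$, $\operatorname{Var}(X)>0$ and $\mathbb{E}X=0$. Then, almost surely, $\liminf_{n\to\infty}G_n=-\infty$ and $\limsup_{n\to\infty}G_n=+\infty$; and for any $x\in\mathbb{R}$, $\liminf_{n\to\infty}|G_n-x|=0$ almost surely. *)

(* Defs.v *)
From HB Require Import structures.
From mathcomp Require Import all_boot all_order all_algebra.
From mathcomp Require Import all_classical all_reals all_analysis.

Set Implicit Arguments.
Unset Strict Implicit.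
Unset Printing Implicit Defensive.

Import Order.TTheory GRing.Theory Num.Theory.
Import numFieldNormedType.Exports.

Local Open Scope classical_set_scope.
Local Open Scope ring_scope.

(* For a random variable X, [distribution P X] unfolds to [pushforward P X];
   taking plain functions lets -X be written as [fun w => - X w].
   Only measurable sets are compared: a measure is a total function on
   [set T'], with no meaningful value on non-measurable sets. *)
Definition identically_distributed d d' (T : measurableType d)
    (T' : measurableType d') (R : realType) (P : probability T R)
    (X Y : T -> T') : Prop :=
  forall A, measurable A -> pushforward P X A = pushforward P Y A.

(* The finite subfamilies are those indexed by duplicate-free lists. *)
Definition mutually_independent d d' (T : measurableType d)
    (T' : measurableType d') (R : realType) (P : probability T R)
    (I : eqType) (X : I -> {RV P >-> T'}) : Prop :=
  forall (s : seq I) (B : I -> set T'), uniq s ->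
    (forall i, measurable (B i)) ->
    P (\bigcap_(i in [set` s]) (X i @^-1` B i)) =
    (\prod_(i <- s) P (X i @^-1` B i))%E.

(* [X] is a generic copy of the common law and need not be independent of the
   sequence. *)
Definition iid_copies d d' (T : measurableType d)
    (T' : measurableType d') (R : realType) (P : probability T R)
    (X : {RV P >-> T'}) (Xs : nat -> {RV P >-> T'}) : Prop :=
  mutually_independent Xs /\ forall i, identically_distributed P (Xs i) X.

(* Sequences of steps are indexed from 0: [Xs i] is X_(i+1), so that
   S_n = X_1 + ... + X_n is the sum of the [Xs i] for i < n. *)
Definition walk d (T : measurableType d) (R : realType) (P : probability T R)
    (Xs : nat -> {RV P >-> R}) (n : nat) (w : T) : R :=
  \sum_(i < n) Xs i w.

(* The value at n = 0 is 0, which is irrelevant for limits. *)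
Definition center_of_mass d (T : measurableType d) (R : realType)
    (P : probability T R) (Xs : nat -> {RV P >-> R}) (n : nat) (w : T) : R :=
  n%:R^-1 * \sum_(1 <= k < n.+1) walk Xs k w.

(* Main.v *)
Require Import Defs.
From mathcomp Require Import all_boot all_order all_algebra.
From mathcomp Require Import all_classical all_reals all_analysis.
From mathcomp Require Import measurable_realfun.
From mathcomp Require Import ring lra.
Import Order.TTheory GRing.Theory Num.Theory.
Import numFieldNormedType.Exports.
Local Open Scope classical_set_scope.
Local Open Scope ring_scope.

Set Implicit Arguments.
Unset Strict Implicit.
Unset Printing Implicit Defensive.

(** Write G_n for the center of mass of the walk S_n; with steps numbered from 0
    it is the linear form sum_(j < n) (n - j) / n * X_j. Both cases of the
    hypothesis give integrable, centered steps that are not almost surely zero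
    ([centered_of_either_case]), and the proof rests on three facts.

    Zero-one law. Changing finitely many steps moves G_n by a bounded amount, so
    unboundedness of G_n from above is a tail event and has probability 0 or 1
    ([kolmogorov_zero_one], [unbounded_above_zero_one]).

    Spread at scale sqrt n. The squared modulus of the characteristic function
    is multiplicative over independent sums, and that of one step at s is at
    most 1 - c s^2 near 0. Since the squares of the weights (n - j) / n add up
    to at least n / 3, the squared modulus for (delta / sqrt n) G_n stays below
    some q < 1. Writing Y_n for (delta / sqrt n) G_n, this bounds E[1 - cos Y_n]
    away from 0 ([spread]).
    If G_n were almost surely bounded above, the positive part of Y_n would tend
    to 0 almost surely. That forces E[1 - cos Y_n] to become small: in the
    symmetric case because the negative part of Y_n has the law of the positive
    part, in the square integrable case because it has the mean of the positive
    part and the second moments are bounded ([one_sub_cos_center]). Hence G_n is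
    almost surely unbounded above ([center_of_mass_unbounded]), and, applying
    this to the steps -X_j, unbounded below.

    Law of large numbers. S_n / n tends to 0 almost surely ([walk_sublinear]).
    This comes from a maximal inequality: if almost surely some partial sum of
    the X_j + c is positive, then E X + c is nonnegative
    ([mean_ge0_of_positive_sum]). For c < 0 the conclusion fails, so the tail
    event that S_n + c n is unbounded above is not sure, hence it is null.

    Finally n (G_n - G_(n-1)) = S_n - G_(n-1), so the increments of G_n tend to 0
    ([cesaro_increments]); a sequence unbounded in both directions with
    vanishing increments passes arbitrarily close to every real number
    infinitely often ([dense_of_oscillation]). *)

(** * Blocks of independent variables and the zero-one law *)

Section blocks.
Context d (T : measurableType d) (R : realType) (P : probability T R).
Context (Xs : nat -> {RV P >-> R}).

(** One infinite intersection, with a bound [n] past which the constraints are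
    trivial, encodes finite cylinders while keeping intersections
    pointwise in [i]. *)
Definition cylinder (K : set nat) : set (set T) :=
  [set A | exists B : nat -> set R, exists n : nat,
    [/\ forall i, measurable (B i),
        forall i, ~ (K i /\ (i < n)%N) -> B i = setT &
        A = \bigcap_i (Xs i @^-1` B i)]].

Definition block (K : set nat) : set (set T) := <<s cylinder K >>.

Lemma cylinderT K : cylinder K setT.
Proof.
exists (fun=> setT), 0%N; split=> //; apply/esym/seteqP; split=> // w _ i _ //.
Qed.

Lemma setI_closed_cylinder K : setI_closed (cylinder K).
Proof.
move=> _ _ [B [n [mB BT ->]]] [C [m [mC CT ->]]].
exists (fun i => B i `&` C i), (maxn n m); split.
- by move=> i; apply: measurableI.
- move=> i Ii; rewrite BT ?CT ?setTI// => -[Ii' im]; apply: Ii; split => //.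
    by rewrite (leq_trans im)// leq_maxr.
  by rewrite (leq_trans im)// leq_maxl.
- by rewrite -bigcapI; apply: eq_bigcapr => i _; rewrite preimage_setI.
Qed.

Lemma cylinder_measurable K : cylinder K `<=` measurable.
Proof.
move=> _ [B [n [mB _ ->]]]; apply: bigcapT_measurable => i.
exact: measurable_funPTI.
Qed.

Lemma block_measurable K : block K `<=` measurable.
Proof.
apply: smallest_sub; last exact: cylinder_measurable.
exact: sigma_algebra_measurable.
Qed.

Lemma cylinder_sub K J : K `<=` J -> cylinder K `<=` cylinder J.
Proof.
move=> KJ _ [B [n [mB BT ->]]]; exists B, n; split=> // i Ji.
by apply: BT => -[Ii iln]; apply: Ji; split => //; apply: KJ.
Qed.

Lemma block_sub K J : K `<=` J -> block K `<=` block J.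
Proof. by move=> KJ; apply: sub_smallest2r; [exact: smallest_sigma_algebra|exact: cylinder_sub]. Qed.

Lemma measurable_block K i : K i ->
  measurable_fun setT (Xs i : g_sigma_algebraType (cylinder K) -> R).
Proof.
move=> Ii _ A mA; rewrite setTI; apply: sub_sigma_algebra.
exists (fun j => if j == i then A else setT), i.+1; split.
- by move=> j; case: ifP.
- by move=> j; case: eqP => // -> [].
- apply/seteqP; split => [w /= Aw j _ /=|w /(_ i I)/=]; last by rewrite eqxx.
  by case: eqP => // ->.
Qed.

Context (ind : mutually_independent Xs).

Lemma prob_cylinder (B : nat -> set R) n : (forall i, measurable (B i)) ->
  (forall i, (n <= i)%N -> B i = setT) ->
  P (\bigcap_i (Xs i @^-1` B i)) = (\prod_(i <- iota 0 n) P (Xs i @^-1` B i))%E.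
Proof.
move=> mB BT; rewrite -(ind (iota_uniq 0 n) mB); congr (P _).
apply/seteqP; split => [w Bw i _|w Bw i _]; first exact: Bw.
have [ni|ni] := leqP n i; first by rewrite BT.
by apply: Bw => /=; rewrite mem_iota.
Qed.

Lemma cylinder_indep K J A B : (forall i, K i -> J i -> False) ->
  cylinder K A -> cylinder J B -> P (A `&` B) = (P A * P B)%E.
Proof.
move=> KJ [C [n [mC CT ->]]] [D [m [mD DT ->]]].
rewrite -bigcapI; under eq_bigcapr do rewrite -preimage_setI.
have C0 i : (maxn n m <= i)%N -> C i = setT.
  by rewrite geq_max => /andP[ni _]; apply: CT => -[_]; rewrite ltnNge ni.
have D0 i : (maxn n m <= i)%N -> D i = setT.
  by rewrite geq_max => /andP[_ mi]; apply: DT => -[_]; rewrite ltnNge mi.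
rewrite (prob_cylinder mC C0) (prob_cylinder mD D0) (@prob_cylinder _ (maxn n m)).
- rewrite -big_split/=; apply: eq_bigr => i _; rewrite preimage_setI.
  have [Ki|Ki] := pselect (K i).
    rewrite (DT i); first by rewrite preimage_setT setIT probability_setT mule1.
    by move=> [Ji _]; exact: KJ Ki Ji.
  by rewrite (CT i) ?preimage_setT ?setTI ?probability_setT ?mul1e// => -[].
- by move=> i; apply: measurableI.
- by move=> i nmi; rewrite C0// D0// setTI.
Qed.

(** The cylinders form a pi-system on which the finite measures [A |-> P (A & E)]
    and [A |-> P A * P E] agree, so they agree on the sigma-algebra. *)
Lemma indep_block_ext K (E : set T) : measurable E ->
  (forall A, cylinder K A -> P (A `&` E) = (P A * P E)%E) ->
  forall A, block K A -> P (A `&` E) = (P A * P E)%E.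
Proof.
move=> mE H A bA.
have fE : (0 <= fine (P E)) by rewrite fine_ge0.
have covT : \bigcup_(k : nat) [set: T] = setT.
  by apply/seteqP; split=> // w _; exists 0%N.
have := @g_sigma_algebra_measure_unique _ R T (cylinder K)
  (@cylinder_measurable K) (fun=> setT) (fun=> cylinderT K) covT
  (mrestr P mE) (mscale (NngNum fE) P) (@setI_closed_cylinder K).
have fEE : (fine (P E))%:E = P E by rewrite fineK// fin_num_measure.
have XX : forall A, mscale (NngNum fE) P A = (P A * P E)%E.
  by move=> B; rewrite /mscale/= fEE muleC.
move=> /(_ _ _ A bA) U; apply: etrans (U _ _) (XX A).
  by move=> B cB; apply: etrans (H B cB) (esym (XX B)).
by move=> _; rewrite /= /mrestr setTI -ge0_fin_numE// fin_num_measure.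
Qed.

(** The extension from cylinders is made twice, once in each argument. *)
Lemma block_indep K J A B : (forall i, K i -> J i -> False) ->
  block K A -> block J B -> P (A `&` B) = (P A * P B)%E.
Proof.
move=> KJ bA bB; apply: (indep_block_ext (K := K)) => //.
  exact: block_measurable bB.
move=> C cC; rewrite setIC muleC; apply: (indep_block_ext (K := J)) => //.
  exact: cylinder_measurable cC.
by move=> D cD; rewrite setIC muleC; exact: cylinder_indep cC cD.
Qed.

(** Kolmogorov's zero-one law: a tail event is independent of every cylinder,
    hence of the sigma-algebra of the whole sequence, hence of itself. *)
Lemma kolmogorov_zero_one A : (forall k, block [set i | (k <= i)%N] A) ->
  P A = 0%E \/ P A = 1%E.
Proof.
move=> tA; have mA : measurable A := block_measurable (tA 0%N).
have : P (A `&` A) = (P A * P A)%E.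
  (* [A] lies in the block of all indices and is tested against cylinders; a
     cylinder constrains the indices below some [n] only. *)
  apply: (indep_block_ext (K := setT)) => //; last first.
    by apply: block_sub (tA 0%N).
  move=> C [B [n [mB BT ->]]].
  apply: (@block_indep [set i | (i < n)%N] [set i | (n <= i)%N]) => //.
    by move=> i /=; rewrite ltnNge => /negP.
  apply: sub_sigma_algebra; exists B, n; split=> // i ni; apply: BT => -[_ iln].
  by apply: ni.
rewrite setIid -(@fineK _ (P A)) ?fin_num_measure// -EFinM => -[] /eqP.
rewrite -subr_eq0 -{1}[fine _]mulr1 -mulrBr mulf_eq0 subr_eq0 => /orP[/eqP ->|/eqP <-]; tauto.
Qed.

End blocks.

(** * Independent pairs and their joint law *)

Section pairs.
Context d (T : measurableType d) (R : realType) (P : probability T R).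

Definition indep_pair (Y Z : T -> R) := forall A B, measurable A -> measurable B ->
  P (Y @^-1` A `&` Z @^-1` B) = (P (Y @^-1` A) * P (Z @^-1` B))%E.

Definition mfun_of d' (T' : measurableType d') (f : T -> T')
  (mf : measurable_fun setT f) : {mfun T >-> T'} := mfun_Sub (mem_set mf).

(** The joint law of [(Y', Z')] is allowed to be written with the marginals of
    other variables [Y], [Z] of the same laws: this is what lets two independent
    pairs with equal marginals be compared. *)
Lemma joint_law (Y Z Y' Z' : T -> R) (mY : measurable_fun setT Y)
    (mZ : measurable_fun setT Z) :
  measurable_fun setT Y' -> measurable_fun setT Z' -> indep_pair Y' Z' ->
  identically_distributed P Y Y' -> identically_distributed P Z Z' ->
  forall C : set (R * R), measurable C ->
  (distribution P (mfun_of mY) \x distribution P (mfun_of mZ))%E C =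
  P ((fun w => (Y' w, Z' w)) @^-1` C).
Proof.
move=> mY' mZ' ind YY' ZZ' C mC.
have mYZ : measurable_fun setT (fun w => (Y' w, Z' w)) by exact: measurable_fun_pair.
apply: (@product_measure_unique _ _ _ _ _ _ _ (distribution P (mfun_of mYZ))) => //.
move=> A B mA mB.
transitivity (P (Y' @^-1` A `&` Z' @^-1` B)); first by [].
by rewrite ind//; congr (_ * _)%E; apply/esym; [exact: YY'|exact: ZZ'].
Qed.

Lemma identically_distributed_pair (Y Z Y' Z' : T -> R) (h : R * R -> R) :
  measurable_fun setT h ->
  measurable_fun setT Y -> measurable_fun setT Z ->
  measurable_fun setT Y' -> measurable_fun setT Z' ->
  indep_pair Y Z -> indep_pair Y' Z' ->
  identically_distributed P Y Y' -> identically_distributed P Z Z' ->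
  identically_distributed P (fun w => h (Y w, Z w)) (fun w => h (Y' w, Z' w)).
Proof.
move=> mh mY mZ mY' mZ' ind ind' YY' ZZ' A mA.
have mhA : measurable (h @^-1` A) by rewrite -[_ @^-1` _]setTI; exact: mh.
apply: etrans (joint_law mY mZ mY' mZ' ind' YY' ZZ' mhA).
by apply/esym; apply: joint_law.
Qed.

Lemma identically_distributed_comp (Y Y' : T -> R) (h : R -> R) :
  measurable_fun setT h -> identically_distributed P Y Y' ->
  identically_distributed P (h \o Y) (h \o Y').
Proof.
move=> mh YY' A mA; apply: (YY' (h @^-1` A)).
by rewrite -[_ @^-1` _]setTI; exact: mh.
Qed.

Lemma ge0_integral_id (Y Y' : T -> R) (f : R -> \bar R) :
  measurable_fun setT Y -> measurable_fun setT Y' ->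
  identically_distributed P Y Y' -> measurable_fun [set: R] f ->
  (forall x, 0 <= f x)%E ->
  (\int[P]_w f (Y w) = \int[P]_w f (Y' w))%E.
Proof.
move=> mY mY' YY' mf f0.
transitivity (\int[distribution P (mfun_of mY)]_y f y)%E.
  by rewrite ge0_integral_distribution.
transitivity (\int[distribution P (mfun_of mY')]_y f y)%E; last first.
  by rewrite ge0_integral_distribution.
by apply: eq_measure_integral => A mA _; exact: YY'.
Qed.

Lemma integrable_id (Y Y' : T -> R) (f : R -> R) :
  measurable_fun setT Y -> measurable_fun setT Y' ->
  identically_distributed P Y Y' -> measurable_fun setT f ->
  P.-integrable setT (EFin \o (f \o Y)) -> P.-integrable setT (EFin \o (f \o Y')).
Proof.
move=> mY mY' YY' mf /integrableP[m1 i1]; apply/integrableP; split.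
  by apply/measurable_EFinP; apply: measurableT_comp.
rewrite -(@ge0_integral_id Y Y' (fun x => `|(f x)%:E|)%E)//.
by apply: measurableT_comp => //; exact/measurable_EFinP.
Qed.

Lemma Rintegral_id (Y Y' : T -> R) (f : R -> R) :
  measurable_fun setT Y -> measurable_fun setT Y' ->
  identically_distributed P Y Y' -> measurable_fun setT f ->
  \int[P]_w f (Y w) = \int[P]_w f (Y' w).
Proof.
move=> mY mY' YY' mf; congr fine; rewrite [LHS]integralE [RHS]integralE.
have mf' : measurable_fun setT (EFin \o f) by exact/measurable_EFinP.
congr (_ - _)%E.
  under eq_integral do rewrite (funepos_comp (EFin \o f) Y).
  under [RHS]eq_integral do rewrite (funepos_comp (EFin \o f) Y').
  by apply: (ge0_integral_id mY mY' YY') => //; exact: measurable_funepos.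
under eq_integral do rewrite (funeneg_comp (EFin \o f) Y).
under [RHS]eq_integral do rewrite (funeneg_comp (EFin \o f) Y').
by apply: (ge0_integral_id mY mY' YY') => //; exact: measurable_funeneg.
Qed.

Lemma indep_pair_comp (Y Z : T -> R) (f g : R -> R) :
  measurable_fun setT f -> measurable_fun setT g ->
  indep_pair Y Z -> indep_pair (f \o Y) (g \o Z).
Proof.
move=> mf mg ind A B mA mB; apply: (ind (f @^-1` A) (g @^-1` B)).
  by rewrite -[_ @^-1` _]setTI; exact: mf.
by rewrite -[_ @^-1` _]setTI; exact: mg.
Qed.

(** Fubini for the joint law, which is a product measure. *)
Lemma indep_pairM (Y Z : T -> R) : indep_pair Y Z ->
  P.-integrable setT (EFin \o Y) -> P.-integrable setT (EFin \o Z) ->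
  P.-integrable setT (EFin \o (fun w => Y w * Z w)) /\
  \int[P]_w (Y w * Z w) = (\int[P]_w Y w) * (\int[P]_w Z w).
Proof.
move=> ind iY iZ.
have mY : measurable_fun setT Y by apply/measurable_EFinP; case/integrableP: iY.
have mZ : measurable_fun setT Z by apply/measurable_EFinP; case/integrableP: iZ.
have mYZ : measurable_fun setT (fun w => (Y w, Z w)) by exact: measurable_fun_pair.
set mu := distribution P (mfun_of mY); set nu := distribution P (mfun_of mZ).
pose f (z : R * R) := (z.1 * z.2)%:E.
have mf : measurable_fun setT f.
  by apply/measurable_EFinP; apply: measurable_funM.
have jl := joint_law mY mZ mY mZ ind (fun _ _ => erefl) (fun _ _ => erefl).
have mid : measurable_fun setT (EFin : R -> \bar R) by exact/measurable_EFinP.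
have E1 : (\int[mu]_y `|y%:E| = \int[P]_w `|(Y w)%:E|)%E.
  by rewrite ge0_integral_distribution//; exact: measurableT_comp.
have E2 : (\int[nu]_y `|y%:E| = \int[P]_w `|(Z w)%:E|)%E.
  by rewrite ge0_integral_distribution//; exact: measurableT_comp.
have imu : mu.-integrable setT (EFin : R -> \bar R).
  by apply/integrableP; split=> //; rewrite E1; case/integrableP: iY.
have inu : nu.-integrable setT (EFin : R -> \bar R).
  by apply/integrableP; split=> //; rewrite E2; case/integrableP: iZ.
have if_ : (mu \x nu)%E.-integrable setT f.
  apply/integrable12ltyP => //.
  under eq_integral => x _.
    under eq_integral do rewrite /f/= normrM EFinM.
    rewrite ge0_integralZl//; last exact: measurableT_comp.
    over.
  rewrite ge0_integralZr//; [|exact: measurableT_comp|exact: integral_ge0].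
  apply: lte_mul_pinfty; first exact: integral_ge0.
    by rewrite ge0_fin_numE; [case/integrableP: imu|exact: integral_ge0].
  by case/integrableP: inu.
pose D := distribution P (mfun_of mYZ).
have iP : P.-integrable setT (EFin \o (fun w => Y w * Z w)).
  apply/integrableP; split.
    by apply/measurable_EFinP; exact: measurable_funM.
  have -> : (\int[P]_x `|(EFin \o (fun w => (Y w * Z w)%R)) x|  =
     \int[D]_z `|f z|)%E.
    by rewrite ge0_integral_distribution//; exact: measurableT_comp.
  rewrite (eq_measure_integral (mu \x nu)%E).
    by case/integrableP: if_.
  by move=> A mA _; apply/esym; exact: jl.
split=> //.
rewrite /Rintegral -fineM; [|exact: integrable_fin_num..]; congr fine.
transitivity (\int[D]_z f z)%E; first by rewrite integral_distribution.
rewrite (eq_measure_integral (mu \x nu)%E); last first.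
  by move=> A mA _; apply/esym; exact: jl.
rewrite -integral12_prod_meas1// /fubini_F/=.
under eq_integral => x _.
  under eq_integral do rewrite /f/= EFinM.
  rewrite integralZl//.
  over.
have fZ : (\int[nu]_y y%:E = \int[P]_w (Z w)%:E)%E.
  by rewrite integral_distribution.
have fY : (\int[mu]_y y%:E = \int[P]_w (Y w)%:E)%E.
  by rewrite integral_distribution.
have fin : (\int[nu]_y y%:E)%E \is a fin_num by exact: integrable_fin_num inu.
rewrite -(fineK fin) integralZr// fineK// fY fZ//.
Qed.

End pairs.

(** * Linear forms in the steps and their unboundedness *)

Section iid_sequence.
Context d (T : measurableType d) (R : realType) (P : probability T R).
Context (Xs : nat -> {RV P >-> R}).

Definition block_fun (K : set nat) (f : T -> R) :=
  measurable_fun setT (f : g_sigma_algebraType (cylinder Xs K) -> R).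

Lemma block_fun_measurable K f : block_fun K f -> measurable_fun setT f.
Proof.
by move=> mf _ A mA; apply: (@block_measurable _ _ _ _ Xs K); exact: mf.
Qed.

Lemma block_fun_indep K J f g : mutually_independent Xs ->
  (forall i, K i -> J i -> False) -> block_fun K f -> block_fun J g ->
  indep_pair P f g.
Proof.
move=> ind KJ mf mg A B mA mB; apply: (block_indep ind KJ).
  by rewrite -[_ @^-1` _]setTI; exact: mf.
by rewrite -[_ @^-1` _]setTI; exact: mg.
Qed.

Definition linear_form (a : nat -> R) (n : nat) (w : T) : R :=
  \sum_(j < n) a j * Xs j w.

Lemma linear_formS a n : linear_form a n.+1 =
  fun w => linear_form a n w + a n * Xs n w.
Proof. by apply/funext => w; rewrite /linear_form big_ord_recr. Qed.

Lemma block_fun_linear_form K a n : (forall j, ~ K j -> (j < n)%N -> a j = 0) ->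
  block_fun K (linear_form a n).
Proof.
move=> aK; rewrite /block_fun /linear_form.
apply: measurable_sum => j; have [Kj|Kj] := pselect (K j).
  by apply: measurable_funM => //; exact: measurable_block.
rewrite aK//; have -> : (fun w => 0 * Xs j w) = cst 0.
  by apply/funext => w; rewrite mul0r.
exact: measurable_cst.
Qed.

Lemma measurable_linear_form a n : measurable_fun setT (linear_form a n).
Proof.
by apply: (@block_fun_measurable setT); apply: block_fun_linear_form => j /(_ I).
Qed.

Definition unbounded_above (h : nat -> T -> R) : set T :=
  [set w | forall M : nat, exists n, M%:R < h n w].

Lemma block_unbounded_above K h : (forall n, block_fun K (h n)) ->
  block Xs K (unbounded_above h).
Proof.
move=> mh.
have -> : unbounded_above h =
    \bigcap_(M : nat) \bigcup_(n : nat) (h n @^-1` `]M%:R, +oo[).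
  apply/seteqP; split => w Hw M.
    by move=> _; have [n hn] := Hw M; exists n => //=; rewrite in_itv/= hn.
  by have [n _ /=] := Hw M I; rewrite in_itv/= andbT; exists n.
have H : (@measurable _ (g_sigma_algebraType (cylinder Xs K)))
    (\bigcap_(M : nat) \bigcup_(n : nat) (h n @^-1` `]M%:R, +oo[)).
  apply: bigcapT_measurable => M; apply: bigcupT_measurable => n.
  by rewrite -[_ @^-1` _]setTI; exact: mh.
exact: H.
Qed.

Lemma unbounded_above_perturb (h h' : nat -> T -> R) (C : T -> R) :
  (forall n w, h n w <= h' n w + C w) -> unbounded_above h `<=` unbounded_above h'.
Proof.
move=> hh' w Uw M; have [n hn] := Uw (M + (Num.truncn (C w)).+1)%N.
exists n; rewrite -(ltrD2r (C w)); apply: lt_le_trans (hh' n w).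
apply: le_lt_trans hn; rewrite natrD lerD2l ltW// truncnS_gt//.
Qed.

(** Zeroing the coefficients of index below [k] moves the form by at most
    [\sum_(j < k) `|X_j|], uniformly in [n], and so preserves unboundedness;
    afterwards the event depends on the steps from [k] on only. *)
Lemma unbounded_above_zero_one (a : nat -> nat -> R) (b : nat -> R) :
  mutually_independent Xs -> (forall n j, `|a n j| <= 1) ->
  let U := unbounded_above (fun n w => linear_form (a n) n w + b n) in
  P U = 0%E \/ P U = 1%E.
Proof.
move=> ind a1 U; apply: (kolmogorov_zero_one ind) => k.
pose a' n j := if (j < k)%N then 0 else a n j.
have bd n w : `|linear_form (a n) n w - linear_form (a' n) n w| <= \sum_(j < k) `|Xs j w|.
  rewrite -sumrB; apply: le_trans (ler_norm_sum _ _ _) _.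
  apply: (@le_trans _ _ (\sum_(j < n | (j < k)%N) `|Xs j w|)).
    rewrite [leRHS]big_mkcond/=; apply: ler_sum => j _; rewrite /a'.
    case: ifP => jk; last by rewrite subrr normr0.
    by rewrite mul0r subr0 normrM ler_piMl.
  rewrite -(big_mkord (fun j => (j < k)%N) (fun j => `|Xs j w|)).
  rewrite -(big_mkord xpredT (fun j => `|Xs j w|)).
  rewrite (big_nat_widen _ _ (maxn n k)) ?leq_maxl//.
  rewrite [leRHS](big_nat_widen _ _ (maxn n k)) ?leq_maxr//=.
  rewrite [leLHS]big_mkcond [leRHS]big_mkcond/=; apply: ler_sum => j _.
  case: (j < k)%N; case: (j < n)%N; rewrite ?andbF ?andbT /=; rewrite ?lexx ?normr_ge0 //.
have -> : U = unbounded_above (fun n w => linear_form (a' n) n w + b n).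
  apply/seteqP; split; apply: (@unbounded_above_perturb _ _ (fun w => \sum_(j < k) `|Xs j w|)) => n w;
    have := bd n w; rewrite ler_norml => /andP[]; lra.
apply: block_unbounded_above => n; apply: measurable_funD => //.
apply: block_fun_linear_form => j /= /negP; rewrite -ltnNge => jk _.
by rewrite /a' jk.
Qed.

End iid_sequence.

(** * Expectations of real functions *)

Section integrability.
Context d (T : measurableType d) (R : realType) (P : probability T R).

Implicit Types f g : T -> R.

Definition integ (f : T -> R) := P.-integrable [set: T] (EFin \o f).

Lemma integ_measurable f : integ f -> measurable_fun setT f.
Proof. by move=> /integrableP[/measurable_EFinP]. Qed.

Lemma integ_le f g : measurable_fun setT f -> (forall w, `|f w| <= g w) ->
  integ g -> integ f.
Proof.
move=> mf fg; apply: le_integrable => //; first exact/measurable_EFinP.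
by move=> w _ /=; rewrite lee_fin (le_trans (fg w))// ler_norm.
Qed.

Lemma integ_cst c : integ (fun=> c).
Proof. exact: finite_measure_integrable_cst. Qed.

Lemma integD f g : integ f -> integ g -> integ (fun w => f w + g w).
Proof. exact: integrableD. Qed.

Lemma integZl a f : integ f -> integ (fun w => a * f w).
Proof. exact: integrableZl. Qed.

Lemma integ_norm f : integ f -> integ (fun w => `|f w|).
Proof. exact: integrable_norm. Qed.

Lemma integ_bounded c f : measurable_fun setT f -> (forall w, `|f w| <= c) -> integ f.
Proof. by move=> mf fc; apply: integ_le (integ_cst c). Qed.

Lemma RintZl a f : integ f -> \int[P]_w (a * f w) = a * \int[P]_w f w.
Proof. exact: RintegralZl. Qed.

Lemma RintD f g : integ f -> integ g ->
  \int[P]_w (f w + g w) = \int[P]_w f w + \int[P]_w g w.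
Proof. exact: RintegralD. Qed.

Lemma RintB f g : integ f -> integ g ->
  \int[P]_w (f w - g w) = \int[P]_w f w - \int[P]_w g w.
Proof. exact: RintegralB. Qed.

Lemma Rint_cst c : \int[P]_w c = c :> R.
Proof. rewrite Rintegral_cst//.
have e : fine (P setT) = 1 by rewrite probability_setT.
by apply: etrans (congr1 (GRing.mul c) e) (mulr1 c). Qed.

Lemma Rint_le f g : integ f -> integ g -> (forall w, f w <= g w) ->
  \int[P]_w f w <= \int[P]_w g w.
Proof. by move=> f1 g1 fg; exact: le_Rintegral. Qed.

Lemma Rint_dominated (f_ : nat -> T -> R) f g :
  (forall n, measurable_fun setT (f_ n)) -> measurable_fun setT f ->
  (forall n w, `|f_ n w| <= g w) -> integ g ->
  {ae P, forall w, f_ n w @[n --> \oo] --> f w} ->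
  \int[P]_w f_ n w @[n --> \oo] --> \int[P]_w f w.
Proof.
move=> mf_ mf f_g ig ff.
have [||||i0 _ +] := @dominated_convergence _ T R P setT measurableT
  (fun n w => (f_ n w)%:E) (EFin \o f) (EFin \o g) _ _ _ ig.
- by move=> n; exact/measurable_EFinP.
- exact/measurable_EFinP.
- apply: filterS ff => w fw _; apply: cvg_comp fw _; exact: cvg_refl.
- by apply: aeW => w n _; rewrite lee_fin.
have fin : (\int[P]_w (EFin \o f) w)%E \is a fin_num by exact: integrable_fin_num.
by rewrite -(fineK fin) => /fine_cvg.
Qed.

End integrability.

(** * The maximal inequality for stationary partial sums *)

Section maximal.
Context d (T : measurableType d) (R : realType) (P : probability T R).
Context (Xs : nat -> {RV P >-> R}) (ind : mutually_independent Xs).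
Context (id : forall i, identically_distributed P (Xs i) (Xs 0%N)).
Context (iX : integ P (Xs 0%N)).

(** The maximum of 0 and the first [n] partial sums of [X_j + c], [j >= k]. The
    recursion peels off the first step, which is independent of the
    remaining maximum. *)
Fixpoint running_max (c : R) (n k : nat) (w : T) : R :=
  if n is n'.+1 then Num.max 0 (Xs k w + c + running_max c n' k.+1 w) else 0.

Lemma running_max_ge0 c n k w : 0 <= running_max c n k w.
Proof. by case: n => //= n; rewrite le_max lexx. Qed.

Lemma block_running_max c n k :
  block_fun Xs [set i | (k <= i)%N] (running_max c n k).
Proof.
elim: n k => [|n IH] k /=; first exact: measurable_cst.
apply: (@measurable_maxr _ _ _ _ (cst 0)); first exact: measurable_cst.
apply: measurable_funD; first apply: measurable_funD => //.
- by apply: measurable_block => /=.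
- move=> _ A mA; apply: (@block_sub _ _ _ _ _ [set i | (k.+1 <= i)%N]).
    by move=> i /=; exact: ltnW.
  exact: IH.
Qed.

Lemma measurable_running_max c n k : measurable_fun setT (running_max c n k).
Proof. apply: block_fun_measurable; exact: block_running_max. Qed.

(** Stationarity, by induction: the pair of the first step and the maximum over
    the later ones has a product law whose marginals do not depend on [k]. *)
Lemma running_max_id c n k l :
  identically_distributed P (running_max c n k) (running_max c n l).
Proof.
elim: n k l => [//|n IH] k l /=.
pose h (z : R * R) := Num.max 0 (z.1 + c + z.2).
have mh : measurable_fun setT h.
  apply: (@measurable_maxr _ _ _ _ (cst 0)); first exact: measurable_cst.
  apply: measurable_funD => //; exact: measurable_funD.
have indk j : indep_pair P (Xs j) (running_max c n j.+1).
  apply: (block_fun_indep (K := fun i => i = j)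
    (J := [set i | (j.+1 <= i)%N]) ind).
  - by move=> _ -> /=; rewrite ltnn.
  - exact: measurable_block.
  - exact: block_running_max.
apply: (identically_distributed_pair mh) => //.
- exact: measurable_running_max.
- exact: measurable_running_max.
- by move=> A mA; rewrite (id k)// (id l).
Qed.

Lemma integ_Xs i : integ P (Xs i).
Proof.
apply: (integrable_id (f := fun x => x) _ _ _ _ iX) => //.
by move=> A mA; rewrite (id i).
Qed.

Lemma integ_running_max c n k : integ P (running_max c n k).
Proof.
elim: n k => [|n IH] k /=; first exact: integ_cst.
apply: (@integ_le _ _ _ _ _ (fun w => `|Xs k w + c + running_max c n k.+1 w|)).
- exact: (measurable_running_max c n.+1 k).
- move=> w; rewrite ger0_norm; last by rewrite le_max lexx.
  by rewrite ge_max normr_ge0 ler_norm.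
- apply: integ_norm; apply: integD => //; apply: integD; last exact: integ_cst.
  exact: integ_Xs.
Qed.

Lemma running_maxS c n k w : running_max c n k w <= running_max c n.+1 k w.
Proof.
elim: n k => [|n IH] k; first exact: running_max_ge0.
rewrite [leLHS]/= [leRHS]/=; apply: le_max2 => //; rewrite lerD2l; exact: IH.
Qed.

Lemma sum_le_running_max c m k w :
  \sum_(j < m) (Xs (k + j)%N w + c) <= running_max c m k w.
Proof.
elim: m k => [|m IH] k; first by rewrite big_ord0.
rewrite big_ord_recl/= addn0 le_max; apply/orP; right.
rewrite lerD2l; apply: le_trans (IH k.+1).
by apply: ler_sum => j _; rewrite /bump/= add1n addnS addSn.
Qed.

Lemma running_max_homo c n m k w : (n <= m)%N ->
  running_max c n k w <= running_max c m k w.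
Proof.
elim: m => [|m IH]; first by rewrite leqn0 => /eqP ->.
rewrite leq_eqVlt => /predU1P[-> //|nm].
exact: le_trans (IH nm) (running_maxS c m k w).
Qed.

Let gain c n w := (Xs 0%N w + c) * (0 < running_max c n.+1 0 w)%R%:R.

Let measurable_gain c n : measurable_fun setT (gain c n).
Proof.
apply: measurable_funM; first exact: measurable_funD.
have -> : (fun w => (0 < running_max c n.+1 0 w)%R%:R) =
    \1_(running_max c n.+1 0 @^-1` `]0, +oo[) :> (T -> R).
  apply/funext => w; rewrite indicE; congr (_%:R); congr nat_of_bool.
  by apply/idP/idP; rewrite ?inE/= ?in_itv/= ?andbT.
apply: measurable_indic; rewrite -[_ @^-1` _]setTI.
by apply: measurable_running_max.
Qed.

(** Hopf's maximal inequality. Where the maximum [M_(n+1)] over the steps from 0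
    on is positive, the shifted first step equals [M_(n+1) - M'_n] with [M'_n] the maximum
    over the steps from 1 on; elsewhere that difference is at most 0. Its
    expectation is nonnegative, since [M'_n] has the law of [M_n <= M_(n+1)]. *)
Lemma maximal_inequality c n :
  0 <= \int[P]_w ((Xs 0%N w + c) * (0 < running_max c n.+1 0 w)%R%:R).
Proof.
have i1 : integ P (gain c n).
  apply: (@integ_le _ _ _ _ _ (fun w => `|Xs 0%N w + c|)) => //.
    by move=> w; rewrite normrM ler_piMr//; case: (0 < _); rewrite /= ?normr1 ?normr0.
  by apply: integ_norm; apply: integD => //; exact: integ_cst.
have i2 : integ P (fun w => -1 * running_max c n 1 w).
  by apply: integZl; exact: integ_running_max.
apply: (@le_trans _ _ (\int[P]_w (running_max c n.+1 0 w + -1 * running_max c n 1 w))); last first.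
  apply: Rint_le => //; first by apply: integD => //; exact: integ_running_max.
  move=> w /=; rewrite mulN1r.
  have := running_max_ge0 c n 1 w; move: (running_max c n 1 w) => W W0.
  case: ltP; rewrite /= ?mulr1 ?mulr0; last by rewrite ?lerBlDr ?add0r => /le_trans; apply.
  by rewrite lt_max ltxx/= => /ltW /max_idPr ->; rewrite addrK.
rewrite RintD//; last exact: integ_running_max.
rewrite RintZl; last exact: integ_running_max.
rewrite mulN1r subr_ge0.
rewrite (Rintegral_id (f := fun x => x) _ _ (running_max_id c n 1 0)) //; try exact: measurable_running_max.
apply: Rint_le => [||w]; try exact: integ_running_max.
exact: running_maxS.
Qed.

(** The indicator in the maximal inequality increases to 1 almost surely, so
    dominated convergence removes it. *)
Lemma mean_ge0_of_positive_sum c :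
  {ae P, forall w, exists n, 0 < \sum_(j < n) (Xs j w + c)} ->
  0 <= \int[P]_w Xs 0%N w + c.
Proof.
move=> ae.
have -> : \int[P]_w Xs 0%N w + c = \int[P]_w (Xs 0%N w + c).
  by rewrite RintD// ?Rint_cst//; exact: integ_cst.
have cv : \int[P]_w (gain c n w) @[n --> \oo] --> \int[P]_w (Xs 0%N w + c).
  apply: (@Rint_dominated _ _ _ _ _ _ (fun w => `|Xs 0%N w + c|)) => //.
  - exact: measurable_funD.
  - by move=> n w; rewrite /gain normrM ler_piMr//; case: (0 < _); rewrite /= ?normr1 ?normr0.
  - by apply: integ_norm; apply: integD => //; exact: integ_cst.
  - apply: filterS ae => w [m m0]; apply: cvg_near_cst.
    exists m => // n /= mn; rewrite /gain.
    have -> : 0 < running_max c n.+1 0 w; last by rewrite mulr1.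
    apply: lt_le_trans m0 _; apply: le_trans (sum_le_running_max c m 0 w) _.
    by apply: running_max_homo; exact: leqW.
by apply: (cvgr_to_ge cv); apply: nearW => n; exact: maximal_inequality.
Qed.

End maximal.

(** * Oscillating sequences and their averages *)

Section real_sequences.
Context (R : realType).
Implicit Types u g s : nat -> R.

Lemma unbounded_tail u : (forall M : nat, exists n, M%:R < u n) ->
  forall (y : R) (N : nat), exists2 n, (N <= n)%N & y < u n.
Proof.
move=> uu y N; pose B := `|y| + \sum_(k < N) `|u k|.
have [n Hn] := uu (Num.truncn B).+1.
have Bn : B < u n by apply: lt_trans Hn; exact: truncnS_gt.
exists n.
  rewrite leqNgt; apply/negP => nN; move: Bn; apply/negP; rewrite -leNgt.
  rewrite /B (bigD1 (Ordinal nN))//= (le_trans (ler_norm _))//.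
  by rewrite addrCA lerDl addr_ge0// sumr_ge0.
apply: le_lt_trans Bn; rewrite (le_trans (ler_norm _))// lerDl.
by rewrite sumr_ge0.
Qed.

Lemma limn_esup_unbounded u : (forall M : nat, exists n, M%:R < u n) ->
  limn_esup (fun n => (u n)%:E) = +oo%E.
Proof.
move=> uu; rewrite limn_esup_lim.
have -> : esups (fun n => (u n)%:E) = cst +oo%E.
  apply/funext => N; apply/eq_infty => y.
  have [n Nn yn] := unbounded_tail uu y N.
  apply: le_trans (ereal_sup_ubound _); last by exists n.
  by rewrite lee_fin ltW.
exact: lim_cst.
Qed.

Lemma limn_einf_unbounded u : (forall M : nat, exists n, M%:R < - u n) ->
  limn_einf (fun n => (u n)%:E) = -oo%E.
Proof.
move=> uu; rewrite /limn_einf.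
by have -> : (\- (fun n => (u n)%:E))%E = (fun n => (- u n)%:E)%E by [];
  rewrite limn_esup_unbounded.
Qed.

Lemma limn_einf_dist0 u (x : R) :
  (forall (e : R) (N : nat), 0 < e -> exists2 n, (N <= n)%N & `|u n - x| <= e) ->
  limn_einf (fun n => (`|u n - x|)%:E) = 0%E.
Proof.
move=> uu; rewrite limn_einf_lim.
have -> : einfs (fun n => (`|u n - x|)%:E) = cst 0%E.
  apply/funext => N; apply/eqP; rewrite eq_le; apply/andP; split; last first.
    by apply: le_ereal_inf_tmp => _ [n /= _ <-]; rewrite lee_fin.
  apply/lee_addgt0Pr => e e0; rewrite add0e.
  have [n Nn un] := uu e N e0.
  apply: le_trans (ereal_inf_lbound _) _; first by exists n.
  by rewrite lee_fin.
exact: lim_cst.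
Qed.

(** [s n / n] tends to 0, in a form that involves only countably many
    conditions and is stable under averaging. *)
Definition sublinear s :=
  forall m : nat, exists M : nat, forall n, `|s n| <= n%:R / m.+1%:R + M%:R.

Lemma cesaro_step s g n : (forall n, g n = n%:R^-1 * \sum_(1 <= k < n.+1) s k) ->
  n.+1%:R * (g n.+1 - g n) = s n.+1 - g n.
Proof.
move=> gE; have ng k : k%:R * g k = \sum_(1 <= i < k.+1) s i.
  rewrite gE; case: k => [|k]; first by rewrite big_geq// !mulr0.
  by rewrite mulrA mulfV ?mul1r// pnatr_eq0.
rewrite mulrBr ng big_nat_recr//= -ng -[n.+1]addn1 natrD mulrDl mul1r; ring.
Qed.

Lemma cesaro_bound s g (c M : R) : 0 <= c -> 0 <= M ->
  (forall n, g n = n%:R^-1 * \sum_(1 <= k < n.+1) s k) ->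
  (forall n, `|s n| <= n%:R * c + M) -> forall n, `|g n| <= n%:R * c + M.
Proof.
move=> c0 M0 gE sb [|n]; first by rewrite gE big_geq// mulr0 normr0 mul0r add0r.
rewrite gE normrM gtr0_norm ?invr_gt0// ler_pdivrMl//.
apply: le_trans (ler_norm_sum _ _ _) _.
apply: (@le_trans _ _ (\sum_(1 <= k < n.+2) (n.+1%:R * c + M))).
  rewrite big_nat [leRHS]big_nat; apply: ler_sum => k /andP[_ kn].
  apply: le_trans (sb k) _; rewrite lerD2r ler_wpM2r// ler_nat//.
by rewrite sumr_const_nat subn1/= [leRHS]mulr_natl.
Qed.

Lemma cesaro_increments s g : sublinear s ->
  (forall n, g n = n%:R^-1 * \sum_(1 <= k < n.+1) s k) ->
  forall e : R, 0 < e -> exists N, forall n, (N <= n)%N -> `|g n.+1 - g n| <= e.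
Proof.
move=> ss gE e e0.
have [m mP] : exists m : nat, 4 / e < m.+1%:R.
  by exists (Num.truncn (4 / e)); exact: truncnS_gt.
have [M MP] := ss m.
have gP := cesaro_bound (c := m.+1%:R^-1) (M := M%:R) _ _ gE MP.
have {}gP n : `|g n| <= n%:R / m.+1%:R + M%:R by apply: gP; rewrite ?invr_ge0.
(* In absolute value [s n.+1] and [g n] are at most [n.+1 * (e / 4) + M]; from this
   index on the two constants [M] together cost at most [n * (e / 2)]. *)
exists (Num.truncn (4 * M%:R / e)).+1 => n Nn.
have nP : 4 * M%:R / e < n%:R.
  by apply: lt_le_trans (truncnS_gt _) _; rewrite ler_nat.
have n1 : 0 < n.+1%:R :> R by [].
rewrite -(ler_pM2l n1) -[X in X * `|_|](gtr0_norm n1) -normrM (cesaro_step n gE).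
apply: le_trans (ler_normB _ _) _.
have m0 : 0 < m.+1%:R :> R by [].
have im : m.+1%:R^-1 <= e / 4.
  by rewrite -[e / 4]invrK invf_div lef_pV2 ?posrE ?divr_gt0// ltW.
have im0 : 0 < m.+1%:R^-1 :> R by rewrite invr_gt0.
have h1 : `|g n| <= n%:R * (e / 4) + M%:R.
  by apply: le_trans (gP n) _; rewrite lerD2r ler_wpM2l.
have h2 : `|s n.+1| <= n.+1%:R * (e / 4) + M%:R.
  by apply: le_trans (MP n.+1) _; rewrite lerD2r ler_wpM2l.
move: nP; rewrite ltr_pdivrMr// => nP.
have n2 : n.+1%:R = n%:R + 1 :> R by rewrite -natr1.
rewrite n2 in h2 *; apply: le_trans (lerD h2 h1) _.
move: (n%:R) (M%:R) nP => a b nP; lra.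
Qed.

(** Between an index where [g] is below [x] and a later one where it is above,
    the first upcrossing of [x] lands within one increment of [x]. *)
Lemma dense_of_oscillation g :
  (forall e : R, 0 < e -> exists N, forall n, (N <= n)%N -> `|g n.+1 - g n| <= e) ->
  (forall M : nat, exists n, M%:R < g n) ->
  (forall M : nat, exists n, M%:R < - g n) ->
  forall x (e : R) (N : nat), 0 < e -> exists2 n, (N <= n)%N & `|g n - x| <= e.
Proof.
move=> inc up down x e N e0; have [N1 N1P] := inc e e0.
have [n1 n1N gn1] := unbounded_tail down (- x) (maxn N N1).
rewrite ltrN2 in gn1.
have [n2 n2N gn2] := unbounded_tail up x n1.
have ex : exists n, (n1 <= n)%N && (x <= g n).
  by exists n2; rewrite n2N ltW.
case: (ex_minnP ex) => n /andP[n1n xn] minn.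
have n1ltn : (n1 < n)%N.
  by rewrite ltn_neqAle n1n andbT; apply/eqP => e1; move: xn; rewrite -e1 leNgt gn1.
case: n => [//|n] in n1n xn minn n1ltn *.
exists n.+1; first by rewrite (leq_trans _ n1n)// (leq_trans _ n1N)// leq_maxl.
have gnx : g n < x.
  rewrite ltNge; apply/negP => xgn; have := minn n.
  by rewrite xgn -ltnS n1ltn ltnn => /(_ isT).
have := N1P n; rewrite (leq_trans _ (n1ltn : n1 <= n)%N) ?(leq_trans _ n1N) ?leq_maxr//.
move=> /(_ isT); rewrite !ler_norml; move=> /andP[_ h]; apply/andP; split; lra.
Qed.

End real_sequences.

(** * The strong law of large numbers *)

Section law_of_large_numbers.
Context d (T : measurableType d) (R : realType) (P : probability T R).

Lemma ae_of_prob1 (A : set T) : measurable A -> P A = 1%E -> {ae P, forall w, A w}.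
Proof.
move=> mA A1; exists (~` A); split=> //; first exact: measurableC.
by rewrite probability_setC// A1 subee.
Qed.

Lemma ae_of_prob0 (A : set T) : measurable A -> P A = 0%E -> {ae P, forall w, ~ A w}.
Proof. by move=> mA A0; exists A; split=> // w /= /contrapT. Qed.

Lemma measurable_opp (X : {RV P >-> R}) : measurable_fun setT (fun w => - X w).
Proof. exact: measurable_funN. Qed.

Definition opp_RV (X : {RV P >-> R}) : {RV P >-> R} := mfun_of (measurable_opp X).

Lemma preimage_opp (A : set R) : measurable A -> measurable (-%R @^-1` A).
Proof. by move=> mA; rewrite -[_ @^-1` _]setTI; exact: oppr_measurable. Qed.

Lemma integ_opp (X : {RV P >-> R}) : integ P X -> integ P (opp_RV X).
Proof.
move=> iX; apply: integ_le (integ_norm iX); first exact: measurable_opp.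
by move=> w; rewrite /= normrN.
Qed.

Lemma Rint_opp (X : {RV P >-> R}) : integ P X ->
  \int[P]_w opp_RV X w = - \int[P]_w X w.
Proof.
move=> iX; rewrite -mulN1r -RintZl//.
by apply: eq_Rintegral => w _; rewrite mulN1r.
Qed.

Lemma Rint_norm_opp (X : {RV P >-> R}) :
  \int[P]_w `|opp_RV X w| = \int[P]_w `|X w|.
Proof. by apply: eq_Rintegral => w _; rewrite /= normrN. Qed.

Lemma mutually_independent_opp (Xs : nat -> {RV P >-> R}) :
  mutually_independent Xs -> mutually_independent (fun i => opp_RV (Xs i)).
Proof.
move=> ind s B us mB.
by apply: (ind s (fun i => -%R @^-1` B i) us) => i; exact: preimage_opp.
Qed.

Lemma identically_distributed_opp (Xs : nat -> {RV P >-> R}) :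
  (forall i, identically_distributed P (Xs i) (Xs 0%N)) ->
  forall i, identically_distributed P (opp_RV (Xs i)) (opp_RV (Xs 0%N)).
Proof.
by move=> id i A mA; apply: (id i (-%R @^-1` A)); exact: preimage_opp.
Qed.

Lemma walkE (Xs : nat -> {RV P >-> R}) n w : walk Xs n w = linear_form Xs (fun=> 1) n w.
Proof. by apply: eq_bigr => j _; rewrite mul1r. Qed.

Lemma walk_opp (Xs : nat -> {RV P >-> R}) n w :
  walk (fun i => opp_RV (Xs i)) n w = - walk Xs n w.
Proof. by rewrite -sumrN. Qed.

Lemma measurable_unbounded_above (Xs : nat -> {RV P >-> R}) (a : nat -> nat -> R) b :
  measurable (unbounded_above (fun n w => linear_form Xs (a n) n w + b n)).
Proof.
apply: (@block_measurable _ _ _ P Xs setT); apply: block_unbounded_above => n.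
apply: measurable_funD => //; apply: block_fun_linear_form => j; by move/(_ I).
Qed.

(** For each slope [1 / (m + 1)] the event that [S_n - n / (m + 1)] is unbounded
    above has probability 0 or 1. Probability 1 would make some partial sum of
    the steps [X_j - 1 / (m + 1)] positive almost surely, although these steps
    have negative mean. *)
Lemma walk_upper_sublinear (Xs : nat -> {RV P >-> R}) :
  mutually_independent Xs ->
  (forall i, identically_distributed P (Xs i) (Xs 0%N)) ->
  integ P (Xs 0%N) -> \int[P]_w Xs 0%N w = 0 ->
  {ae P, forall w, forall m : nat, exists M : nat,
    forall n, walk Xs n w <= n%:R / m.+1%:R + M%:R}.
Proof.
move=> ind id iX X0; apply/ae_foralln => m.
pose b (n : nat) : R := - (n%:R / m.+1%:R).
pose U := unbounded_above (fun n w => linear_form Xs (fun=> 1) n w + b n).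
have mU : measurable U by exact: (measurable_unbounded_above Xs (fun _ _ => 1) b).
have [|U0|U1] := unbounded_above_zero_one (a := fun _ _ => 1) b ind.
- by move=> *; rewrite normr1.
- apply: filterS (ae_of_prob0 mU U0) => w nU.
  have [M HM] : exists M : nat, ~ exists n, M%:R < linear_form Xs (fun=> 1) n w + b n.
    by apply/existsNP.
  exists M => n; rewrite walkE leNgt; apply/negP => lt; apply: HM; exists n.
  by rewrite /b ltrBrDl.
- have : 0 <= \int[P]_w Xs 0%N w + - m.+1%:R^-1.
    apply: (mean_ge0_of_positive_sum ind id iX).
    apply: filterS (ae_of_prob1 mU U1) => w /(_ 0%N)[n].
    rewrite /linear_form /b => h; exists n; apply: lt_le_trans h _.
    rewrite big_split/= sumr_const card_ord.
    have -> : \sum_(j < n) 1 * Xs j w = \sum_(j < n) Xs j w.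
      by apply: eq_bigr => j _; rewrite mul1r.
    by rewrite mulNrn mulr_natl.
  by rewrite X0 add0r oppr_ge0 leNgt invr_gt0 ltr0Sn.
Qed.

(** The strong law of large numbers for integrable centered steps. *)
Lemma walk_sublinear (Xs : nat -> {RV P >-> R}) :
  mutually_independent Xs ->
  (forall i, identically_distributed P (Xs i) (Xs 0%N)) ->
  integ P (Xs 0%N) -> \int[P]_w Xs 0%N w = 0 ->
  {ae P, forall w, sublinear (walk Xs ^~ w)}.
Proof.
move=> ind id iX X0.
have ixN : integ P (opp_RV (Xs 0%N)) := integ_opp iX.
have xN0 : \int[P]_w opp_RV (Xs 0%N) w = 0 by rewrite Rint_opp// X0 oppr0.
apply: filterS2 (walk_upper_sublinear ind id iX X0)
  (walk_upper_sublinear (mutually_independent_opp ind)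
    (identically_distributed_opp id) ixN xN0) => w up down m.
have [M1 H1] := up m; have [M2 H2] := down m.
exists (maxn M1 M2) => n; rewrite ler_norml lerNl -walk_opp; apply/andP; split.
  by apply: le_trans (H2 n) _; rewrite lerD2l ler_nat leq_maxr.
by apply: le_trans (H1 n) _; rewrite lerD2l ler_nat leq_maxl.
Qed.

End law_of_large_numbers.

(** * Bounds on the cosine *)

Section trigonometry.
Context (R : realType).
Implicit Types u : R.

Lemma sin_mvt u : 0 < u -> exists2 x, 0 < x < u & sin u = u * cos x.
Proof.
move=> u0; have [|x xu] := @MVT R sin cos 0 u u0 (fun x _ => is_derive_sin x).
  by apply: continuous_subspaceT => x; exact: continuous_sin.
rewrite sin0 !subr0 => ->; exists x; last by rewrite mulrC.
by move: xu; rewrite in_itv.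
Qed.

Lemma one_sub_cos_le u : 1 - cos u <= `|u|.
Proof.
rewrite -cos_norm; have := normr_ge0 u; move: `|u| => v.
rewrite le_eqVlt => /predU1P[<-|v0]; first by rewrite cos0 subrr.
have [|x xu] := @MVT R cos (fun x => - sin x) 0 v v0 (fun x _ => is_derive_cos x).
  by apply: continuous_subspaceT => x; exact: continuous_cos.
rewrite cos0 subr0 => /(congr1 (fun z => - z)); rewrite opprB => ->.
rewrite mulNr opprK -[leRHS]mul1r ler_wpM2r// ?ltW//; exact: sin_le1.
Qed.

(** [1 - cos u] is [2 * sin (u / 2) ^+ 2], and the sine is at least half its
    argument as long as the cosine stays above 1/2. *)
Lemma one_sub_cos_ge : exists2 r : R, 0 < r &
  forall u, `|u| <= r -> u ^+ 2 / 8 <= 1 - cos u.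
Proof.
have : \forall x \near (0 : R), 1 / 2 < cos x.
  have : cos x @[x --> (0 : R)] --> (1 : R).
    by rewrite -[X in _ --> X]cos0; exact: continuous_cos.
  by move=> /cvgr_gt; apply; lra.
move=> /nbhs_ballP[e /= e0 He]; exists e => // u.
rewrite -[cos u]cos_norm -[u ^+ 2]real_normK ?num_real//.
have := normr_ge0 u; move: `|u| => v; rewrite le_eqVlt => /predU1P[<-|v0].
  by rewrite expr0n/= mul0r cos0 subrr.
move=> ve.
have v2 : 0 < v / 2 by rewrite divr_gt0.
have [x /andP[x0 xv] sx] := sin_mvt v2.
have cx : 1 / 2 < cos x.
  by apply: He; rewrite /ball/= sub0r normrN gtr0_norm//; lra.
have -> : cos v = 1 - 2 * sin (v / 2) ^+ 2.
  by rewrite [v in LHS](_ : v = (v / 2) *+ 2) ?cos_mulr2n ?cos2sin2; lra.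
have s : v / 4 <= sin (v / 2).
  rewrite sx; apply: (@le_trans _ _ (v / 2 * (1 / 2))); first lra.
  by rewrite ler_wpM2l// ltW.
have : (v / 4) ^+ 2 <= sin (v / 2) ^+ 2.
  by rewrite lerXn2r// nnegrE; [rewrite divr_ge0// ltW|rewrite (le_trans _ s)// divr_ge0// ltW].
rewrite expr_div_n; lra.
Qed.

End trigonometry.

(** * The squared modulus of the characteristic function *)

Section characteristic_function.
Context d (T : measurableType d) (R : realType) (P : probability T R).
Implicit Types Y Z : T -> R.

(** The squared modulus of the characteristic function of [Y] at 1; other
    arguments are reached by scaling [Y]. The modulus keeps everything
    real-valued and is still multiplicative. *)
Definition charsq Y : R := (\int[P]_w cos (Y w)) ^+ 2 + (\int[P]_w sin (Y w)) ^+ 2.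

Lemma measurable_cos : measurable_fun setT (@cos R).
Proof. by apply: continuous_measurable_fun; exact: continuous_cos. Qed.

Lemma measurable_sin : measurable_fun setT (@sin R).
Proof. by apply: continuous_measurable_fun; exact: continuous_sin. Qed.

Lemma integ_cos Y : measurable_fun setT Y -> integ P (fun w => cos (Y w)).
Proof.
move=> mY; apply: (@integ_bounded _ _ _ _ 1).
  by apply: measurableT_comp => //; exact: measurable_cos.
by move=> w; exact: cos_max.
Qed.

Lemma integ_sin Y : measurable_fun setT Y -> integ P (fun w => sin (Y w)).
Proof.
move=> mY; apply: (@integ_bounded _ _ _ _ 1).
  by apply: measurableT_comp => //; exact: measurable_sin.
by move=> w; exact: sin_max.
Qed.

Lemma integ_one_sub_cos (Y : T -> R) : measurable_fun setT Y ->
  integ P (fun w => 1 - cos (Y w)).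
Proof.
move=> mY; apply: (@integ_bounded _ _ _ _ 2).
  by apply: measurable_funB => //; apply: (@integ_measurable _ _ _ P); exact: integ_cos.
move=> w; rewrite (le_trans (ler_normB _ _))// normr1.
have := cos_max (Y w); lra.
Qed.

Section sum.
Context Y Z (mY : measurable_fun setT Y) (mZ : measurable_fun setT Z).
Context (ind : indep_pair P Y Z).

Let cc := indep_pairM (indep_pair_comp measurable_cos measurable_cos ind)
  (integ_cos mY) (integ_cos mZ).
Let ss := indep_pairM (indep_pair_comp measurable_sin measurable_sin ind)
  (integ_sin mY) (integ_sin mZ).
Let cs := indep_pairM (indep_pair_comp measurable_cos measurable_sin ind)
  (integ_cos mY) (integ_sin mZ).
Let sc := indep_pairM (indep_pair_comp measurable_sin measurable_cos ind)
  (integ_sin mY) (integ_cos mZ).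

Lemma charsqD : charsq (fun w => Y w + Z w) = charsq Y * charsq Z.
Proof.
rewrite /charsq.
under eq_Rintegral do rewrite cosD.
under [X in _ + X ^+ 2]eq_Rintegral do rewrite sinD.
rewrite RintB ?RintD; [|exact: sc.1|exact: cs.1|exact: cc.1|exact: ss.1].
have -> := cc.2; have -> := ss.2; have -> := cs.2; have -> := sc.2.
rewrite /comp; ring.
Qed.

(** For [Y] and [Z] of the same law this identifies the squared modulus with the
    characteristic function of the symmetrized variable [Y - Z]. *)
Lemma expectation_cosB : \int[P]_w cos (Y w - Z w) =
  (\int[P]_w cos (Y w)) * (\int[P]_w cos (Z w)) +
  (\int[P]_w sin (Y w)) * (\int[P]_w sin (Z w)).
Proof.
under eq_Rintegral do rewrite cosB.
rewrite RintD; [|exact: cc.1|exact: ss.1].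
by have -> := cc.2; have -> := ss.2.
Qed.

End sum.

Lemma charsq_id Y Z : measurable_fun setT Y -> measurable_fun setT Z ->
  identically_distributed P Y Z -> charsq Y = charsq Z.
Proof.
move=> mY mZ YZ; rewrite /charsq (Rintegral_id mY mZ YZ measurable_cos).
by rewrite (Rintegral_id mY mZ YZ measurable_sin).
Qed.

Lemma charsq0 : charsq (fun=> 0) = 1.
Proof. by rewrite /charsq cos0 sin0 !Rint_cst expr1n expr0n addr0. Qed.

Lemma charsq_ge0 Y : 0 <= charsq Y.
Proof. by rewrite addr_ge0// sqr_ge0. Qed.

(** The intervals [[1/(n+1), n+1]] exhaust the open half-line, so they cannot all
    be null. *)
Lemma charge_compact_interval (X : {RV P >-> R}) :
  (0 < P (X @^-1` `]0%R, +oo[))%E ->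
  exists a b : R, [/\ 0 < a, 0 < b & (0 < P (X @^-1` `[a, b]))%E].
Proof.
move=> X0; apply/not_existsP => H.
pose F (n : nat) := X @^-1` `[n.+1%:R^-1, n.+1%:R].
have F0 n : P (F n) = 0%E.
  apply/eqP; rewrite eq_le measure_ge0 andbT leNgt; apply/negP => Fn.
  apply: (H n.+1%:R^-1); exists n.+1%:R; split=> //.
have : P.-negligible (\bigcup_n F n).
  apply: negligible_bigcup => n; apply/negligibleP; last exact: F0.
  exact: measurable_funPTI.
move=> /negligibleS; move/(_ (X @^-1` `]0, +oo[)) => H1.
have {H1}/negligibleP H1 : P.-negligible (X @^-1` `]0, +oo[).
  apply: H1 => w /=; rewrite in_itv/= andbT => Xw.
  exists (maxn (Num.truncn (X w)) (Num.truncn (X w)^-1)) => //=.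
  rewrite /F/= in_itv/=; apply/andP; split.
    rewrite -[leRHS]invrK lef_pV2 ?posrE ?invr_gt0//.
    by rewrite ltW// (lt_le_trans (truncnS_gt _))// ler_nat ltnS leq_maxr.
  by rewrite ltW// (lt_le_trans (truncnS_gt _))// ler_nat ltnS leq_maxl.
by move: X0; rewrite H1 ?ltxx//; exact: measurable_funPTI.
Qed.

(** Otherwise [`|X|] would be [- X] almost surely, of mean 0. *)
Lemma centered_positive (X : {RV P >-> R}) : integ P X ->
  \int[P]_w X w = 0 -> 0 < \int[P]_w `|X w| -> (0 < P (X @^-1` `]0%R, +oo[))%E.
Proof.
move=> iX X0 aX; rewrite lt_neqAle measure_ge0 andbT eq_sym; apply/eqP => PX.
have mX : measurable (X @^-1` `]0, +oo[) by exact: measurable_funPTI.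
move: aX; rewrite (_ : \int[P]_w `|X w| = \int[P]_w (-1 * X w)).
  by rewrite RintZl// X0 mulr0 ltxx.
congr fine; apply: ae_eq_integral => //.
- apply/measurable_EFinP; exact: integ_measurable (integ_norm iX).
- apply/measurable_EFinP; exact: integ_measurable (integZl _ iX).
apply: filterS (ae_of_prob0 mX PX) => w /= nX _; congr EFin.
rewrite mulN1r ler0_norm// leNgt; apply/negP => Xw; apply: nX.
by rewrite in_itv/= Xw.
Qed.

End characteristic_function.

(** * The center of mass spreads at scale sqrt n *)

Section anticoncentration.
Context d (T : measurableType d) (R : realType) (P : probability T R).
Context (Xs : nat -> {RV P >-> R}) (ind : mutually_independent Xs).
Context (id : forall i, identically_distributed P (Xs i) (Xs 0%N)).
Context (iX : integ P (Xs 0%N)) (X0 : \int[P]_w Xs 0%N w = 0).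
Context (aX : 0 < \int[P]_w `|Xs 0%N w|).

Lemma id_scale a i : identically_distributed P (fun w => a * Xs i w) (fun w => a * Xs 0%N w).
Proof.
apply: (@identically_distributed_comp _ _ _ _ (Xs i) (Xs 0%N) (fun x => a * x)) => //.
exact: measurable_funM.
Qed.

Lemma measurable_scale a i : measurable_fun setT (fun w => a * Xs i w).
Proof. exact: measurable_funM. Qed.

Lemma linear_form_indep a n : indep_pair P (linear_form Xs a n) (fun w => a n * Xs n w).
Proof.
apply: (block_fun_indep (K := [set i | (i < n)%N]) (J := fun i => i = n) ind).
- by move=> i /= + e; rewrite e ltnn.
- by apply: block_fun_linear_form => j /= nj jn; case: nj.
- by apply: measurable_funM; [exact: measurable_cst|exact: measurable_block].
Qed.

Lemma charsq_linear_form a n :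
  charsq P (linear_form Xs a n) = \prod_(j < n) charsq P (fun w => a j * Xs 0%N w).
Proof.
elim: n => [|n IH].
  rewrite big_ord0 -[RHS](charsq0 P); congr charsq; apply/funext => w.
  by rewrite /linear_form big_ord0.
rewrite big_ord_recr/= -IH linear_formS charsqD//.
- by congr (_ * _); apply: charsq_id; [exact: measurable_scale|exact: measurable_scale|exact: id_scale].
- exact: measurable_linear_form.
- exact: measurable_scale.
- exact: linear_form_indep.
Qed.

Lemma pair_indep i j : i != j -> indep_pair P (Xs i) (Xs j).
Proof.
move=> ij; apply: (block_fun_indep (K := fun k => k = i) (J := fun k => k = j) ind).
- by move=> k -> /eqP; rewrite (negPf ij).
- exact: measurable_block.
- exact: measurable_block.
Qed.

(** A centered nonzero variable charges both half-lines, so with positive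
    probability the first step lies in a compact interval on the right of 0 while
    the independent second one lies in a compact interval on the left. *)
Lemma centered_two_sided : exists a b : R, [/\ 0 < a, 0 < b &
  exists2 p : R, 0 < p & exists E : set T, [/\ measurable E, P E = p%:E &
    forall w, E w -> a <= Xs 0%N w - Xs 1%N w <= b]].
Proof.
have iN : integ P (opp_RV (Xs 0%N)) := integ_opp iX.
have xN0 : \int[P]_w opp_RV (Xs 0%N) w = 0 by rewrite Rint_opp// X0 oppr0.
have aN : 0 < \int[P]_w `|opp_RV (Xs 0%N) w| by rewrite Rint_norm_opp.
have [a1 [b1 [a10 b10 p1]]] := charge_compact_interval (centered_positive iX X0 aX).
have [a2 [b2 [a20 b20 p2]]] := charge_compact_interval (centered_positive iN xN0 aN).
exists (a1 + a2), (b1 + b2); split; [exact: addr_gt0|exact: addr_gt0|].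
set A := Xs 0%N @^-1` `[a1, b1] in p1.
pose B := Xs 1%N @^-1` (-%R @^-1` `[a2, b2]).
have mo : measurable (-%R @^-1` `[a2, b2] : set R) by exact: preimage_opp.
have mA : measurable A by exact: measurable_funPTI.
have mB : measurable B by exact: measurable_funPTI.
have PAB : P (A `&` B) = (P A * P (opp_RV (Xs 0%N) @^-1` `[a2, b2]))%E.
  rewrite (pair_indep (isT : 0%N != 1%N))//; congr (_ * _)%E.
  exact: (id 1%N mo).
exists (fine (P (A `&` B))).
  by rewrite fine_gt0// PAB mule_gt0//= -PAB -ge0_fin_numE// fin_num_measure//; exact: measurableI.
exists (A `&` B); split; first exact: measurableI.
  by rewrite fineK// fin_num_measure//; exact: measurableI.
move=> w []; rewrite /A /B /= !in_itv/= => /andP[? ?] /andP[? ?]; apply/andP; split; lra.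
Qed.

(** The squared modulus is [E cos (s D)] for the difference [D] of two independent
    steps; where [D] lies in a fixed compact interval of positive numbers,
    [1 - cos (s D)] is of order [s ^+ 2]. *)
Lemma charsq_le_quadratic : exists2 delta : R, 0 < delta & exists2 c : R, 0 < c &
  forall s : R, `|s| <= delta -> charsq P (fun w => s * Xs 0%N w) <= 1 - c * s ^+ 2.
Proof.
have [a [b [a0 b0 [p p0 [E [mE PE HE]]]]]] := centered_two_sided.
have [r r0 Hr] := one_sub_cos_ge R.
exists (r / b); first exact: divr_gt0.
exists (p * (a ^+ 2 / 8)); first by rewrite mulr_gt0// divr_gt0// exprn_gt0.
move=> s sr.
have mD i : measurable_fun setT (fun w => s * Xs i w) by exact: measurable_scale.
have -> : charsq P (fun w => s * Xs 0%N w) = \int[P]_w cos (s * Xs 0%N w - s * Xs 1%N w).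
  rewrite (@expectation_cosB _ _ _ _ (fun w => s * Xs 0%N w) (fun w => s * Xs 1%N w))//; last first.
    apply: (@indep_pair_comp _ _ _ _ (Xs 0%N) (Xs 1%N) ( *%R s) ( *%R s)).
    - exact: measurable_funM.
    - exact: measurable_funM.
    - exact: pair_indep.
  rewrite (Rintegral_id (mD 1%N) (mD 0%N) (id_scale s 1%N) (@measurable_cos R)).
  by rewrite (Rintegral_id (mD 1%N) (mD 0%N) (id_scale s 1%N) (@measurable_sin R)).
rewrite lerBrDr -lerBrDl.
have mdiff : measurable_fun setT (fun w => s * Xs 0%N w - s * Xs 1%N w).
  exact: measurable_funB.
have -> : 1 - \int[P]_w cos (s * Xs 0%N w - s * Xs 1%N w) =
    \int[P]_w (1 - cos (s * Xs 0%N w - s * Xs 1%N w)).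
  by rewrite RintB ?Rint_cst//; [exact: integ_cst|exact: integ_cos].
have iE : integ P (fun w => \1_E w).
  apply: (@integ_bounded _ _ _ _ 1); first exact: measurable_indic.
  by move=> w; rewrite indicE; case: (_ \in _); rewrite ?normr1 ?normr0.
have -> : p * (a ^+ 2 / 8) * s ^+ 2 = \int[P]_w ((s ^+ 2 * a ^+ 2 / 8) * \1_E w).
  rewrite RintZl//.
  have -> : \int[P]_w (\1_E w) = p.
    by rewrite /Rintegral integral_indic// setIT; exact: (congr1 fine PE).
  by ring.
apply: Rint_le; first exact: integZl.
  exact: integ_one_sub_cos mdiff.
move=> w; rewrite indicE; have [wE|wE] := boolP (w \in E); last first.
  by rewrite mulr0 subr_ge0 cos_le1.
have /andP[aw bw] := HE w (set_mem wE).
rewrite mulr1 -mulrBr; apply: le_trans (Hr _ _).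
  rewrite exprMn ler_wpM2r// ler_wpM2l ?sqr_ge0// lerXn2r ?nnegrE ?(ltW a0)//.
  by rewrite (le_trans (ltW a0)).
rewrite normrM (ger0_norm (le_trans (ltW a0) aw)).
apply: (@le_trans _ _ (r / b * b)); last by rewrite divfK ?gt_eqF.
by rewrite ler_pM// (le_trans (ltW a0)).
Qed.

Definition center_weight (n j : nat) : R := (n - j)%:R / n%:R.

Lemma center_of_massE n w :
  center_of_mass Xs n w = linear_form Xs (center_weight n) n w.
Proof.
have H : \sum_(1 <= k < n.+1) walk Xs k w = \sum_(j < n) (n - j)%:R * Xs j w.
  elim: n => [|n IH]; first by rewrite big_geq// big_ord0.
  rewrite big_nat_recr//= IH /walk [RHS]big_ord_recr/= subSnn mul1r.
  rewrite [X in _ + X]big_ord_recr/= addrA; congr (_ + _).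
  rewrite -big_split/=; apply: eq_bigr => j _.
  by rewrite subSn ?(ltnW (ltn_ord j))// -natr1 mulrDl mul1r.
rewrite /center_of_mass H mulr_sumr; apply: eq_bigr => j _.
by rewrite /center_weight mulrA [n%:R^-1 * _]mulrC.
Qed.

Lemma center_weight_bound n j : 0 <= center_weight n j <= 1.
Proof.
rewrite /center_weight; case: n => [|n]; first by rewrite mul0r lexx ler01.
by rewrite divr_ge0//= ler_pdivrMr// mul1r ler_nat leq_subr.
Qed.

Lemma sum_center_weight_sqr n : n%:R / 3 <= \sum_(j < n) center_weight n j ^+ 2.
Proof.
have H : n%:R ^+ 3 / 3 <= \sum_(j < n) ((n - j)%:R ^+ 2 : R).
  elim: n => [|n IH]; first by rewrite big_ord0 expr0n mul0r.
  rewrite big_ord_recl subn0; under eq_bigr do rewrite lift0 subSS.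
  apply: le_trans (lerD (lexx _) IH).
  have n0 : 0 <= n%:R :> R by [].
  rewrite -natr1; move: (n%:R) n0 => x x0; nra.
case: n => [|n] in H *; first by rewrite big_ord0 mul0r.
under eq_bigr do rewrite expr_div_n.
rewrite -mulr_suml ler_pdivlMr ?exprn_gt0//; apply: le_trans H.
by rewrite mulrAC -exprS.
Qed.

(** The squared modulus for the rescaled center of mass is at most
    [q := exp (- c * delta^2 / 3)], uniformly in [n], and it dominates the square
    of [x := E cos]; finally [1 - x >= (1 - x^2) / 2 >= (1 - q) / 2]. *)
Lemma spread : exists2 delta : R, 0 < delta & exists2 eta : R, 0 < eta &
  forall n, (0 < n)%N ->
  eta <= \int[P]_w (1 - cos (delta / Num.sqrt n%:R * center_of_mass Xs n w)).
Proof.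
have [delta d0 [c c0 H]] := charsq_le_quadratic.
exists delta => //; pose q := expR (- (c * delta ^+ 2 / 3)).
exists ((1 - q) / 2).
  rewrite divr_gt0// subr_gt0 /q -expR0 ltr_expR oppr_lt0.
  by rewrite divr_gt0// mulr_gt0// exprn_gt0.
move=> n n0; set t := delta / Num.sqrt n%:R.
have nR : 0 < n%:R :> R by rewrite ltr0n.
have sn : 1 <= Num.sqrt n%:R :> R.
  by rewrite -[leLHS]sqrtr1 ler_wsqrtr// ler1n.
have t0 : 0 <= t by rewrite divr_ge0// ?sqrtr_ge0 ?ltW.
have tdel : t <= delta.
  by rewrite ler_pdivrMr ?(lt_le_trans _ sn)// ler_peMr// ltW.
pose a j := t * center_weight n j.
have lE : (fun w => t * center_of_mass Xs n w) = linear_form Xs a n.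
  apply/funext => w; rewrite center_of_massE /linear_form mulr_sumr.
  by apply: eq_bigr => j _; rewrite mulrA.
have cq : charsq P (linear_form Xs a n) <= q.
  rewrite charsq_linear_form.
  apply: (@le_trans _ _ (\prod_(j < n) expR (- (c * a j ^+ 2)))).
    apply: ler_prod => j _; rewrite charsq_ge0/=.
    have /andP[w0 w1] := center_weight_bound n j.
    apply: le_trans (H _ _) _; last exact: expR_ge1Dx.
    rewrite ger0_norm; last exact: mulr_ge0 t0 w0.
    by apply: le_trans tdel; exact: ler_piMr t0 w1.
  rewrite -expR_sum ler_expR sumrN lerN2 -mulr_sumr.
  under eq_bigr do rewrite exprMn; rewrite -mulr_sumr.
  have -> : t ^+ 2 = delta ^+ 2 / n%:R by rewrite expr_div_n sqr_sqrtr// ltW.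
  have -> : c * delta ^+ 2 / 3 = c * (delta ^+ 2 / n%:R * (n%:R / 3)).
    by field; rewrite gt_eqF.
  apply: ler_wpM2l; first exact: ltW.
  apply: ler_wpM2l; last exact: sum_center_weight_sqr.
  by rewrite divr_ge0 ?sqr_ge0// ltW.
have ml : measurable_fun setT (linear_form Xs a n) by exact: measurable_linear_form.
have -> : \int[P]_w (1 - cos (t * center_of_mass Xs n w)) =
    1 - \int[P]_w cos (linear_form Xs a n w).
  rewrite -lE RintB ?Rint_cst//; first exact: integ_cst.
  by apply: (@integ_cos _ _ _ P (fun w => t * center_of_mass Xs n w)); rewrite lE.
move: cq; rewrite /charsq.
move: (\int[P]_w cos _) (\int[P]_w sin _) q => x y q cq.
have := sqr_ge0 (1 - x); have := sqr_ge0 y; rewrite sqrrB expr1n mul1r.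
lra.
Qed.

End anticoncentration.

(** * Upper bounds from the positive part *)

Section oscillation.
Context d (T : measurableType d) (R : realType) (P : probability T R).

Definition positive_part (x : R) : R := Num.max 0 x.

Lemma measurable_positive_part : measurable_fun setT positive_part.
Proof.
apply: (@measurable_maxr _ _ _ _ (cst 0) (fun x => x)).
  exact: measurable_cst.
exact: measurable_id.
Qed.

Lemma positive_part_ge0 x : 0 <= positive_part x.
Proof. by rewrite le_max lexx. Qed.

Lemma positive_partM a x : 0 <= a -> positive_part (a * x) = a * positive_part x.
Proof. by move=> a0; rewrite /positive_part maxr_pMr// mulr0. Qed.

Lemma measurable_minK (K : R) (f : T -> R) : measurable_fun setT f ->
  measurable_fun setT (fun w => Num.min (positive_part (f w)) K).
Proof.
move=> mf; apply: (@measurable_minr _ _ _ _ (fun w => positive_part (f w)) (cst K)) => //.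
by apply: measurableT_comp => //; exact: measurable_positive_part.
Qed.

Lemma integ_minK (K : R) (f : T -> R) : 0 <= K -> measurable_fun setT f ->
  integ P (fun w => Num.min (positive_part (f w)) K).
Proof.
move=> K0 mf; apply: (@integ_bounded _ _ _ _ K); first exact: measurable_minK.
by move=> w; rewrite ger0_norm ?ge_min ?lexx ?orbT// le_min positive_part_ge0.
Qed.

(** The function [1 - cos] is even and vanishes at 0, so it splits over the positive
    and the negative part, which have the same law; on each it is at most
    the minimum of the part and 2. *)
Lemma one_sub_cos_symmetric (Y : T -> R) : measurable_fun setT Y ->
  identically_distributed P Y (fun w => - Y w) ->
  \int[P]_w (1 - cos (Y w)) <= 2 * \int[P]_w Num.min (positive_part (Y w)) 2.
Proof.
move=> mY sY.
have mNY : measurable_fun setT (fun w => - Y w) by exact: measurable_funN.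
have mpos Z : measurable_fun setT Z -> measurable_fun setT (fun w : T => positive_part (Z w)).
  by move=> mZ; apply: measurableT_comp => //; exact: measurable_positive_part.
pose f x := 1 - cos (positive_part x).
have mf : measurable_fun setT f.
  apply: measurable_funB => //; apply: measurableT_comp; first exact: measurable_cos.
  exact: measurable_positive_part.
have -> : \int[P]_w (1 - cos (Y w)) = \int[P]_w (f (Y w) + f (- Y w)).
  apply: eq_Rintegral => w _; rewrite /f /positive_part; have [y0|y0] := leP 0 (Y w).
    by rewrite max_l ?oppr_le0// cos0 subrr addr0.
  by rewrite max_r ?oppr_ge0 ?ltW// cos0 subrr add0r cosN.
have i1 : integ P (fun w => f (Y w)) by apply: integ_one_sub_cos; exact: mpos.
have i2 : integ P (fun w => f (- Y w)).
  by apply: (@integ_one_sub_cos _ _ _ P (fun w => positive_part (- Y w))); exact: mpos.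
rewrite RintD// -(Rintegral_id mY mNY sY mf).
suff : \int[P]_w f (Y w) <= \int[P]_w Num.min (positive_part (Y w)) 2 by lra.
apply: Rint_le => // [|w]; first exact: integ_minK.
rewrite le_min; apply/andP; split.
  by rewrite -[leRHS]ger0_norm ?positive_part_ge0//; exact: one_sub_cos_le.
have := cos_geN1 (positive_part (Y w)); rewrite /f; lra.
Qed.

(** [1 - cos y] is at most [`|y|], which is twice the positive part minus [y], and
    the term [y] has mean 0. The positive part exceeds its truncation at [K] by at
    most [y ^+ 2 / K]. *)
Lemma one_sub_cos_centered (Y : T -> R) (K : R) : 0 < K -> integ P Y ->
  integ P (fun w => Y w ^+ 2) -> \int[P]_w Y w = 0 ->
  \int[P]_w (1 - cos (Y w)) <=
    2 * \int[P]_w Num.min (positive_part (Y w)) K + 2 / K * \int[P]_w (Y w ^+ 2).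
Proof.
move=> K0 iY iY2 Y0; have mY := integ_measurable iY.
have im := integ_minK (ltW K0) mY.
have -> : 2 * \int[P]_w Num.min (positive_part (Y w)) K + 2 / K * \int[P]_w (Y w ^+ 2) =
    \int[P]_w (2 * Num.min (positive_part (Y w)) K + 2 / K * (Y w ^+ 2) + -1 * Y w).
  rewrite RintD; [|by apply: integD; exact: integZl|exact: integZl].
  rewrite RintD; [|exact: integZl|exact: integZl].
  by rewrite !RintZl// Y0 mulr0 addr0.
apply: Rint_le; first exact: integ_one_sub_cos.
  by apply: integD; [apply: integD|]; exact: integZl.
move=> w; apply: le_trans (one_sub_cos_le _) _.
move: (Y w) => y.
have -> : `|y| = 2 * positive_part y - y.
  rewrite /positive_part; have [y0|y0] := leP 0 y; first by rewrite ger0_norm//; lra.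
  by rewrite ltr0_norm//; lra.
rewrite mulN1r lerD2r -mulrA -mulrDr ler_wpM2l//.
have y2 : 0 <= K^-1 * y ^+ 2 by rewrite mulr_ge0 ?sqr_ge0// invr_ge0 ltW.
rewrite /Num.min; case: ifP => pK; first by rewrite lerDl.
have {}pK : K <= positive_part y by rewrite leNgt pK.
have yK : K <= y by move: pK; rewrite /positive_part le_max => /orP[K'|//]; lra.
have -> : positive_part y = y by rewrite /positive_part max_r//; apply: le_trans yK; exact: ltW.
rewrite -lerBlDl ler_pdivlMl//.
nra.
Qed.

Section iid.
Context (Xs : nat -> {RV P >-> R}) (ind : mutually_independent Xs).
Context (id : forall i, identically_distributed P (Xs i) (Xs 0%N)).
Context (iX : integ P (Xs 0%N)) (X0 : \int[P]_w Xs 0%N w = 0).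

Lemma linear_form_symmetric a n :
  identically_distributed P (Xs 0%N) (fun w => - Xs 0%N w) ->
  identically_distributed P (linear_form Xs a n) (fun w => - linear_form Xs a n w).
Proof.
move=> sX; elim: n => [|n IH].
  have -> // : (fun w => - linear_form Xs a 0 w) = linear_form Xs a 0.
  by apply/funext => w; rewrite /linear_form big_ord0 oppr0.
rewrite linear_formS.
have -> : (fun w => - (linear_form Xs a n w + a n * Xs n w)) =
    (fun w => - linear_form Xs a n w + - (a n * Xs n w)).
  by apply/funext => w; rewrite opprD.
have mh : measurable_fun setT (fun z : R * R => z.1 + z.2) by exact: measurable_funD.
have ml := measurable_linear_form Xs a n.
have ms := measurable_scale Xs (a n) n.
have li := linear_form_indep ind a n.
apply: (identically_distributed_pair mh) => //.
- exact: measurable_funN.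
- exact: measurable_funN.
- by apply: (indep_pair_comp _ _ li); exact: oppr_measurable.
- move=> A mA; rewrite (id_scale id (a n) n mA).
  have mM : measurable_fun setT (fun x : R => a n * x) by exact: measurable_funM.
  have mA' : measurable ((fun x => a n * x) @^-1` A).
    by rewrite -[_ @^-1` _]setTI; exact: mM.
  have e : (fun w => - (a n * Xs n w)) = (fun w => a n * (- Xs n w)).
    by apply/funext => w; rewrite mulrN.
  rewrite e; apply: etrans (sX _ mA') _.
  apply/esym; apply: (id n (A := -%R @^-1` ((fun x => a n * x) @^-1` A))).
  exact: preimage_opp.
Qed.

(** Cross terms vanish because a step is centered and independent of the earlier
    ones. *)
Lemma linear_form_moments a n : integ P (fun w => Xs 0%N w ^+ 2) ->
  [/\ integ P (linear_form Xs a n), \int[P]_w linear_form Xs a n w = 0,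
      integ P (fun w => linear_form Xs a n w ^+ 2) &
      \int[P]_w (linear_form Xs a n w ^+ 2) =
      (\sum_(j < n) a j ^+ 2) * \int[P]_w (Xs 0%N w ^+ 2)].
Proof.
move=> iX2.
have msq : measurable_fun setT (fun x : R => x ^+ 2) by exact: measurable_funX.
have id' j : identically_distributed P (Xs 0%N) (Xs j) by move=> A mA; rewrite (id j).
have iXj j : integ P (Xs j) by exact: integ_Xs id iX j.
have Xj0 j : \int[P]_w Xs j w = 0.
  by rewrite -X0; apply/esym; apply: (Rintegral_id (f := fun x => x) _ _ (id' j)).
have iXj2 j : integ P (fun w => Xs j w ^+ 2).
  by apply: (integrable_id (f := fun x => x ^+ 2) _ _ (id' j)).
have Xj2 j : \int[P]_w (Xs j w ^+ 2) = \int[P]_w (Xs 0%N w ^+ 2).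
  by apply/esym; apply: (Rintegral_id (f := fun x => x ^+ 2) _ _ (id' j)).
elim: n => [|n [il l0 il2 l2]].
  have -> : linear_form Xs a 0 = fun=> 0.
    by apply/funext => w; rewrite /linear_form big_ord0.
  split; [exact: integ_cst|exact: Rint_cst|exact: integ_cst|].
  by rewrite Rint_cst big_ord0 mul0r expr0n.
rewrite linear_formS.
have iaX : integ P (fun w => a n * Xs n w) by exact: integZl.
have aX0 : \int[P]_w (a n * Xs n w) = 0 by rewrite RintZl// Xj0 mulr0.
have [ic c0] := indep_pairM (linear_form_indep ind a n) il iaX.
have sq : (fun w => (linear_form Xs a n w + a n * Xs n w) ^+ 2) =
   (fun w => linear_form Xs a n w ^+ 2 + 2 * (linear_form Xs a n w * (a n * Xs n w))
     + a n ^+ 2 * Xs n w ^+ 2).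
  by apply/funext => w; ring.
have i12 : integ P (fun w => linear_form Xs a n w ^+ 2 +
    2 * (linear_form Xs a n w * (a n * Xs n w))).
  by apply: integD => //; exact: integZl.
split.
- exact: integD.
- by rewrite RintD// l0 aX0 addr0.
- by rewrite sq; apply: integD => //; exact: integZl.
- rewrite sq RintD//; last exact: integZl.
  rewrite RintD//; last exact: integZl.
  rewrite !RintZl// c0 aX0 mulr0 mulr0 addr0 l2 Xj2 big_ord_recr/=.
  by rewrite -mulrDl.
Qed.

End iid.

Definition symmetric_or_square_integrable (X : T -> R) :=
  identically_distributed P X (fun w => - X w) \/ integ P (fun w => X w ^+ 2).

Definition scaled_center (Xs : nat -> {RV P >-> R}) (delta : R) (n : nat) (w : T) : R :=
  delta / Num.sqrt n%:R * center_of_mass Xs n w.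

Lemma scaled_centerE Xs delta n : scaled_center Xs delta n =
  linear_form Xs (fun j => delta / Num.sqrt n%:R * center_weight R n j) n.
Proof.
apply/funext => w; rewrite /scaled_center center_of_massE /linear_form mulr_sumr.
by apply: eq_bigr => j _; rewrite mulrA.
Qed.

(** The common bound for the two cases: [1 - cos] of the rescaled center of mass is
    controlled in mean by its truncated positive part alone. *)
Lemma one_sub_cos_center (Xs : nat -> {RV P >-> R}) (delta eta : R) :
  mutually_independent Xs ->
  (forall i, identically_distributed P (Xs i) (Xs 0%N)) ->
  integ P (Xs 0%N) -> \int[P]_w Xs 0%N w = 0 ->
  symmetric_or_square_integrable (Xs 0%N) -> 0 < delta -> 0 < eta ->
  exists2 K : R, 0 < K & forall n, (0 < n)%N ->
  \int[P]_w (1 - cos (scaled_center Xs delta n w)) <=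
  2 * \int[P]_w Num.min (positive_part (scaled_center Xs delta n w)) K + eta.
Proof.
move=> ind id iX X0 hX d0 e0.
case: hX => [sX|iX2].
  exists 2 => // n n0; rewrite scaled_centerE.
  apply: (le_trans (one_sub_cos_symmetric _ _)).
  - exact: measurable_linear_form.
  - exact: linear_form_symmetric.
  - by rewrite lerDl ltW.
pose s2 := \int[P]_w (Xs 0%N w ^+ 2).
have s20 : 0 <= s2 by apply: Rintegral_ge0 => w _; exact: sqr_ge0.
(* The second moment of the rescaled center of mass is at most [delta ^+ 2 * s2];
   this [K] makes its contribution at most [eta], and the [+ 1] keeps [K]
   positive. *)
pose K := 2 * delta ^+ 2 * s2 / eta + 1.
have K0 : 0 < K.
  by rewrite ltr_wpDl// divr_ge0 ?(ltW e0)// mulr_ge0// mulr_ge0// sqr_ge0.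
exists K => // n n0; rewrite scaled_centerE.
pose a (j : nat) := delta / Num.sqrt n%:R * center_weight R n j; rewrite -/a.
have [il l0 il2 l2] := linear_form_moments ind id iX X0 a n iX2.
apply: le_trans (one_sub_cos_centered K0 il il2 l0) _.
rewrite lerD2l l2 -/s2.
have nR : 0 < n%:R :> R by rewrite ltr0n.
have sa : \sum_(j < n) a j ^+ 2 <= delta ^+ 2.
  apply: (@le_trans _ _ (\sum_(j < n) delta ^+ 2 / n%:R)).
    apply: ler_sum => j _; rewrite /a exprMn expr_div_n sqr_sqrtr; last exact: ltW.
    have /andP[w0 w1] := center_weight_bound R n j.
    by rewrite ler_piMr ?divr_ge0 ?sqr_ge0 ?(ltW nR)// expr_le1.
  by rewrite sumr_const card_ord -[X in X <= _]mulr_natr divfK ?gt_eqF.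
apply: (@le_trans _ _ (2 / K * (delta ^+ 2 * s2))).
  by rewrite ler_wpM2l ?divr_ge0 ?(ltW K0)// ler_wpM2r.
rewrite mulrAC ler_pdivrMr//.
have -> : eta * K = 2 * (delta ^+ 2 * s2) + eta by rewrite /K; field; rewrite gt_eqF.
by rewrite lerDl ltW.
Qed.

End oscillation.

(** * Oscillation of the center of mass *)

Section center_of_mass_oscillates.
Context d (T : measurableType d) (R : realType) (P : probability T R).

(** Only an upper bound on the center of mass is assumed, so it is the positive
    part that the factor [1 / sqrt n] sends to 0. *)
Lemma scaled_center_cvg0 (Xs : nat -> {RV P >-> R}) (delta K : R) :
  0 < delta -> 0 < K ->
  {ae P, forall w, exists M : nat, forall n, center_of_mass Xs n w <= M%:R} ->
  \int[P]_w Num.min (positive_part (scaled_center Xs delta n w)) K @[n --> \oo] --> (0 : R).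
Proof.
move=> d0 K0 bd.
have ms n : measurable_fun setT (scaled_center Xs delta n).
  by rewrite scaled_centerE; exact: measurable_linear_form.
rewrite -[X in _ --> X](Rint_cst P).
apply: (@Rint_dominated _ _ _ _ _ _ (fun=> K)) => //.
- by move=> n; exact: measurable_minK.
- by move=> n w; rewrite ger0_norm ?ge_min ?lexx ?orbT// le_min positive_part_ge0 ltW.
- exact: integ_cst.
apply: filterS bd => w [M HM]; apply/cvgrPdist_le => e e0.
pose N := Num.truncn ((delta * M%:R / e) ^+ 2).
(* [n > N] makes [delta * M / sqrt n] at most [e]. *)
exists N.+1 => // n /= Nn; rewrite sub0r normrN.
have n0 : 0 < n%:R :> R by rewrite ltr0n; exact: leq_trans Nn.
have sn : 0 < Num.sqrt n%:R :> R by rewrite sqrtr_gt0.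
rewrite ger0_norm; last by rewrite le_min positive_part_ge0 ltW.
rewrite ge_min; apply/orP; left.
have t0 : 0 <= delta / Num.sqrt n%:R by rewrite divr_ge0// ltW.
rewrite /scaled_center positive_partM//.
apply: (@le_trans _ _ (delta / Num.sqrt n%:R * M%:R)).
  by rewrite ler_wpM2l// ge_max ler0n HM.
suff H : delta * M%:R / e <= Num.sqrt n%:R.
  by rewrite mulrAC ler_pdivrMr// [e * _]mulrC -ler_pdivrMr.
have q0 : 0 <= delta * M%:R / e by rewrite divr_ge0 ?(ltW e0)// mulr_ge0// ltW.
rewrite -[leLHS](ger0_norm q0) -sqrtr_sqr ler_wsqrtr//.
apply: ltW; apply: lt_le_trans (truncnS_gt _) _.
by rewrite ler_nat.
Qed.

(** If the center of mass were bounded above, the truncated positive part would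
    tend to 0 in mean, contradicting the uniform spread. *)
Lemma center_of_mass_unbounded (Xs : nat -> {RV P >-> R}) :
  mutually_independent Xs ->
  (forall i, identically_distributed P (Xs i) (Xs 0%N)) ->
  integ P (Xs 0%N) -> \int[P]_w Xs 0%N w = 0 -> 0 < \int[P]_w `|Xs 0%N w| ->
  symmetric_or_square_integrable P (Xs 0%N) ->
  {ae P, forall w, forall M : nat, exists n, M%:R < center_of_mass Xs n w}.
Proof.
move=> ind id iX X0 aX hX.
pose U := unbounded_above (fun n w => linear_form Xs (center_weight R n) n w + 0).
have mU : measurable U.
  exact: (measurable_unbounded_above Xs (center_weight R) (fun=> 0)).
have UE w : U w <-> forall M : nat, exists n, M%:R < center_of_mass Xs n w.
  split=> Uw M; have [n Hn] := Uw M; exists n; move: Hn;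
    by rewrite /= addr0 center_of_massE.
have [|U0|U1] := unbounded_above_zero_one (a := center_weight R) (fun=> 0) ind; last 1 first.
- by apply: filterS (ae_of_prob1 mU U1) => w /UE.
- by move=> n j; have /andP[w0 w1] := center_weight_bound R n j; rewrite ger0_norm.
exfalso.
have [delta d0 [eta e0 Heta]] := spread ind id iX X0 aX.
have e2 : 0 < eta / 2 by rewrite divr_gt0.
have [K K0 HK] := one_sub_cos_center ind id iX X0 hX d0 e2.
have bd : {ae P, forall w, exists M : nat, forall n, center_of_mass Xs n w <= M%:R}.
  apply: filterS (ae_of_prob0 mU U0) => w nU.
  have /existsNP[M HM] : ~ forall M : nat, exists n, M%:R < center_of_mass Xs n w.
    by move=> H; apply: nU; apply/UE.
  by exists M => n; rewrite leNgt; apply/negP => lt; apply: HM; exists n.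
have /cvgrPdist_lt/(_ (eta / 8)) := scaled_center_cvg0 d0 K0 bd.
have e8 : 0 < eta / 8 by rewrite divr_gt0.
move=> /(_ e8)[N _ HN].
have := HN N.+1 (leqnSn N); rewrite /= sub0r normrN => /ltr_normlW.
have := HK N.+1 isT; have := Heta N.+1 isT.
move: (\int[P]_w Num.min _ _) (\int[P]_w (1 - _)) => x y; lra.
Qed.

Lemma center_of_mass_opp (Xs : nat -> {RV P >-> R}) n w :
  center_of_mass (fun i => opp_RV (Xs i)) n w = - center_of_mass Xs n w.
Proof.
rewrite /center_of_mass -mulrN -sumrN; congr (_ * _).
by apply: eq_bigr => k _; rewrite walk_opp.
Qed.

Lemma center_of_mass_oscillates (Xs : nat -> {RV P >-> R}) :
  mutually_independent Xs ->
  (forall i, identically_distributed P (Xs i) (Xs 0%N)) ->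
  integ P (Xs 0%N) -> \int[P]_w Xs 0%N w = 0 -> 0 < \int[P]_w `|Xs 0%N w| ->
  symmetric_or_square_integrable P (Xs 0%N) ->
  {ae P, forall w, [/\ sublinear (walk Xs ^~ w),
    forall M : nat, exists n, M%:R < center_of_mass Xs n w &
    forall M : nat, exists n, M%:R < - center_of_mass Xs n w]}.
Proof.
move=> ind id iX X0 aX hX.
have iN : integ P (opp_RV (Xs 0%N)) := integ_opp iX.
have xN0 : \int[P]_w opp_RV (Xs 0%N) w = 0 by rewrite Rint_opp// X0 oppr0.
have aN : 0 < \int[P]_w `|opp_RV (Xs 0%N) w| by rewrite Rint_norm_opp.
have hN : symmetric_or_square_integrable P (opp_RV (Xs 0%N)).
  case: hX => [sX|iX2]; [left|right].
    by move=> A mA; exact: (sX (-%R @^-1` A) (preimage_opp mA)).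
  rewrite (_ : (fun w => _) = (fun w => Xs 0%N w ^+ 2))//.
  by apply/funext => w; rewrite /= sqrrN.
have H1 := walk_sublinear ind id iX X0.
have H2 := center_of_mass_unbounded ind id iX X0 aX hX.
have H3 := center_of_mass_unbounded (mutually_independent_opp ind)
   (identically_distributed_opp id) iN xN0 aN hN.
apply: filterS3 H1 H2 H3 => w h1 h2 h3; split=> // M.
by have [n Hn] := h3 M; exists n; rewrite -center_of_mass_opp.
Qed.

End center_of_mass_oscillates.

(** Symmetry forces the mean to be its own opposite. In the square integrable
    case, a vanishing first absolute moment would make the variance vanish. *)
Lemma centered_of_either_case (d : measure_display) (T : measurableType d)
    (R : realType) (P : probability T R) (X : {RV P >-> R}) :
  [/\ (0 < 'E_P[fun w => `|X w|%R])%E, ('E_P[fun w => `|X w|%R] < +oo)%E &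
          identically_distributed P X (fun w => - X w)]
      \/
      [/\ ('E_P[fun w => (X w ^+ 2)%R] < +oo)%E, (0 < 'V_P[X])%E &
          ('E_P[X] = 0)%E] ->
  [/\ integ P X, \int[P]_w X w = 0, 0 < \int[P]_w `|X w| &
    symmetric_or_square_integrable P X].
Proof.
have mX : measurable_fun setT X by [].
have mXn : measurable_fun setT (fun w => `|X w|) by exact: measurableT_comp.
have mX2 : measurable_fun setT (fun w => X w ^+ 2) by exact: measurable_funX.
have mXN : measurable_fun setT (fun w => - X w) by exact: measurable_opp.
case=> [[aX aXy sX]|[X2y VX EX]].
  have iX : integ P X.
    apply/integrableP; split; first exact/measurable_EFinP.
    by move: aXy; rewrite unlock.
  split=> //.
  - have := Rintegral_id (f := fun x => x) mX mXN sX (@measurable_id _ _ _).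
    rewrite (_ : \int[P]_w (- X w) = - \int[P]_w X w); first lra.
    by rewrite -mulN1r -RintZl//; apply: eq_Rintegral => w _; rewrite mulN1r.
  - rewrite /Rintegral fine_gt0//; move: aX aXy; rewrite unlock => -> ->//.
  - by left.
have iX2 : integ P (fun w => X w ^+ 2).
  apply/integrableP; split; first exact/measurable_EFinP.
  move: X2y; rewrite unlock; apply: le_lt_trans.
  rewrite le_eqVlt; apply/orP; left; apply/eqP; apply: eq_integral => w _.
  by rewrite /= ger0_norm ?sqr_ge0.
have iX : integ P X.
  apply: (@integ_le _ _ _ _ _ (fun w => 1 + X w ^+ 2)) => //.
    move=> w; rewrite -[X w ^+ 2]real_normK ?num_real//.
    have := sqr_ge0 (`|X w| - 1); rewrite sqrrB mulr1 expr1n.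
    have := sqr_ge0 `|X w|; lra.
  by apply: integD => //; exact: integ_cst.
split=> //; last by right.
  by move: EX; rewrite /Rintegral unlock => ->.
rewrite lt_neqAle Rintegral_ge0// andbT eq_sym; apply/eqP => aX0.
have : (\int[P]_w `|(X w)%:E| = 0)%E.
  rewrite -[LHS]fineK; first by rewrite -[0%E]/(0%:E); congr EFin.
  exact: (integrable_fin_num measurableT (integ_norm iX)).
have mXe : measurable_fun setT (EFin \o X) by exact/measurable_EFinP.
move=> /(ae_eq_integral_abs P measurableT mXe) Xae.
move: VX; rewrite /variance covariance.unlock EX/= [X in (_ < X)%E](_ : _ = 0%E) ?ltxx//.
rewrite unlock; transitivity (\int[P]_w 0)%E; last exact: integral0.
apply: ae_eq_integral => //.
- by apply/measurable_EFinP; apply: measurable_funM; exact: measurable_funB.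
- apply: filterS Xae => w /(_ I)/= [Xw] _.
  by rewrite /GRing.mul/= Xw subrr mulr0.
Qed.

Theorem theorem7p4p1 (d : measure_display) (T : measurableType d)
    (R : realType) (P : probability T R)
    (X : {RV P >-> R}) (Xs : nat -> {RV P >-> R})
    (hiid : iid_copies X Xs)
    (hX :
      [/\ (0 < 'E_P[fun w => `|X w|%R])%E, ('E_P[fun w => `|X w|%R] < +oo)%E &
          identically_distributed P X (fun w => - X w)]
      \/
      [/\ ('E_P[fun w => (X w ^+ 2)%R] < +oo)%E, (0 < 'V_P[X])%E &
          ('E_P[X] = 0)%E]) :
  {ae P, forall w,
     limn_einf (fun n => (center_of_mass Xs n w)%:E) = -oo%E /\
     limn_esup (fun n => (center_of_mass Xs n w)%:E) = +oo%E} /\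
  (forall x : R,
     {ae P, forall w,
        limn_einf (fun n => (`|center_of_mass Xs n w - x|)%:E) = 0%E}).
Proof.
have [ind idX] := hiid.
have mX : measurable_fun setT X by [].
have [iX X0 aX sX] := centered_of_either_case hX.
have id0 i : identically_distributed P (Xs i) (Xs 0%N).
  by move=> A mA; rewrite (idX i)// (idX 0%N).
have id0X : identically_distributed P X (Xs 0%N).
  by move=> A mA; rewrite (idX 0%N).
have m0 : measurable_fun setT (Xs 0%N) by [].
have osc := @center_of_mass_oscillates _ _ _ P Xs ind id0.
have {}osc : {ae P, forall w, [/\ sublinear (walk Xs ^~ w),
    forall M : nat, exists n, M%:R < center_of_mass Xs n w &
    forall M : nat, exists n, M%:R < - center_of_mass Xs n w]}.
  apply: osc.
  - by apply: (integrable_id (f := fun x => x) _ _ id0X).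
  - by rewrite -X0; apply/esym; apply: (Rintegral_id (f := fun x => x) _ _ id0X).
  - by rewrite -(Rintegral_id (f := fun x => `|x|) _ _ id0X).
  - case: sX => [sX|iX2]; [left|right].
      move=> A mA; rewrite -(id0X A mA) (sX A mA).
      exact: (id0X (-%R @^-1` A) (preimage_opp mA)).
    by apply: (integrable_id (f := fun x => x ^+ 2) _ _ id0X) => //; exact: measurable_funX.
split; [|move=> x]; apply: filterS osc => w [sub up down].
  by split; [exact: limn_einf_unbounded|exact: limn_esup_unbounded].
apply: limn_einf_dist0 => e N e0; apply: dense_of_oscillation => //.
exact: (cesaro_increments sub).
Qed.
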